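(* Let $L$ be a $d$-dimensional closed convex set in $\mathbb{R}^d$. Then the following conditions are equivalent. (i) $R_L$ maps every polyhedron in $\mathbb{R}^d$ to a polyhedron; that is, for every polyhedron $P\subseteq\mathbb{R}^d$ the set $R_L(P)$ is a polyhedron. (ii) $R_L$ maps every closed convex set in $\mathbb{R}^d$ to a closed convex set; that is, for every closed convex set $K\subseteq\mathbb{R}^d$ the set $R_L(K)$ is closed and convex. (iii) Either $L$ is a halfspace or $\operatorname{rec}(L)$ is a linear space.
   Context: Here $d\in\mathbb{N}=\{1,2,\ldots\}$. For a closed convex set $K\subseteq\mathbb{R}^d$ (not necessarily $d$-dimensional) and a $d$-dimensional closed convex set $L$, $R_L(K):=\operatorname{conv}(K\setminus\operatorname{int}(L))$. A polyhedron is an intersection of finitely many closed halfspaces of $\mathbb{R}^d$ (the empty set and $\mathbb{R}^d$ are polyhedra; polyhedra need not be bounded). The recession cone of a nonempty closed convex set $K$ is $\operatorname{rec}(K)=\{y\in\mathbb{R}^d : x+ty\in K\ \forall x\in K\ \forall t\ge 0\}$. *)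

(* Defs.v *)
From HB Require Import structures.
From mathcomp Require Import all_boot all_order all_algebra.
From mathcomp Require Import all_classical all_reals.
From mathcomp Require Import topology normedtype convex.

Set Implicit Arguments.
Unset Strict Implicit.
Unset Printing Implicit Defensive.

Import Order.TTheory GRing.Theory Num.Theory.
Import numFieldNormedType.Exports.

Local Open Scope classical_set_scope.
Local Open Scope ring_scope.

(* Row vectors 'rV[R]_d over R : realType model the Euclidean space R^d; the
   sup-norm topology of the library is the usual topology. *)

Definition convex_hull (R : realType) (d : nat) (A : set 'rV[R]_d) :
  set 'rV[R]_d := smallest (@convex_set R 'rV[R]_d) A.

Definition affine_set (R : realType) (d : nat) (A : set 'rV[R]_d) : Prop :=
  forall (x y : 'rV[R]_d) (t : R), A x -> A y -> A ((1 - t) *: x + t *: y).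

Definition affine_hull (R : realType) (d : nat) (A : set 'rV[R]_d) :
  set 'rV[R]_d := smallest (@affine_set R d) A.

(* The dimension of a nonempty set is that of its affine hull x + V. *)
Definition has_dim (R : realType) (d : nat) (A : set 'rV[R]_d) (k : nat) :
  Prop :=
  exists (x : 'rV[R]_d) (V : {vspace 'rV[R]_d}),
    affine_hull A = [set x + v | v in [set` V]] /\ \dim V = k.

(* Closed halfspaces; the normal vector a must be nonzero. *)
Definition is_halfspace (R : realType) (d : nat) (H : set 'rV[R]_d) : Prop :=
  exists (a : 'rV[R]_d) (b : R),
    a != 0 /\ H = [set x : 'rV[R]_d | \sum_(i < d) a 0 i * x 0 i <= b].

(* n = 0 gives the whole space. *)
Definition polyhedron (R : realType) (d : nat) (P : set 'rV[R]_d) : Prop :=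
  exists (n : nat) (H : 'I_n -> set 'rV[R]_d),
    (forall i, is_halfspace (H i)) /\ P = \bigcap_(i in [set: 'I_n]) H i.

Definition rec_cone (R : realType) (d : nat) (K : set 'rV[R]_d) :
  set 'rV[R]_d :=
  [set y | forall x : 'rV[R]_d, K x -> forall t : R, 0 <= t -> K (x + t *: y)].

Definition is_linear_space (R : realType) (d : nat) (A : set 'rV[R]_d) :
  Prop := exists V : {vspace 'rV[R]_d}, A = [set` V].

Definition RL (R : realType) (d : nat) (L K : set 'rV[R]_d) : set 'rV[R]_d :=
  convex_hull (K `\` interior L).

(* Main.v *)
Require Import Defs.
From mathcomp Require Import all_boot all_order all_algebra.
From mathcomp Require Import all_classical all_reals.
From mathcomp Require Import topology normedtype convex sequences derive.
From mathcomp Require Import interval_inference.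
From mathcomp Require Import ring lra.
Set Implicit Arguments.
Unset Strict Implicit.
Unset Printing Implicit Defensive.

Import Order.TTheory GRing.Theory Num.Theory.
Import numFieldNormedType.Exports.

Local Open Scope classical_set_scope.
Local Open Scope ring_scope.

(** Write [S] for [K `\` L°], so that [RL L K] is the convex hull of [S].

    Sufficiency.  If [L] is a halfspace, [S] is the intersection of [K] with the
    opposite closed halfspace, hence already convex ([RL_halfspace]).  Let now
    [rec_cone L] be a linear space.  Everything rests on the fact that [RL L K]
    absorbs the recession directions of [K] ([RL_rec_cone]): for [x] in [S] and
    [r] in [rec_cone K], either [r] is in [rec_cone L] and then [x + r] is
    outside the interior of [L] since [- r] is a recession direction of [L] too,
    or the ray from [x] along [r] finally leaves [L], so that [x + r] lies
    between two points of [S].  Lines contained in [K] are harmless: if one of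
    them is transversal to [rec_cone L] then [RL L K] is [K]
    ([RL_transversal_line]), and otherwise [S] is invariant under all of them.

    - For a polyhedron [K] there is a finite subset [F] of [S] such that [S] is
      contained in the hull of [F] plus the recession cone ([faces_generated]).
      This is shown by induction on the faces.  In a face which is at least
      two-dimensional modulo lines, a hyperplane supporting [L] at a point of
      [S] contains a line of the face through this point; the line misses the
      interior of [L] and leads to smaller faces, or to infinity.  An edge is
      treated with the closedness of [S].  Absorption then gives equality of
      [RL L K] with the hull of [F] plus the recession cone, which is a
      polyhedron by Fourier-Motzkin elimination ([cone_add_generator]).

    - For a closed convex [K], a limit of points of the hull of [S] is a limit
      of combinations of [d + 1] points of [S] ([caratheodory]).  Along an
      ultrafilter the weights converge, and each weighted point tends to a
      multiple of a point of [S] or to a recession direction of [K].  The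
      weighted points stay bounded, since after rescaling they would tend to
      recession directions adding up to zero but not all zero, which is
      impossible modulo the lines of [K].  So the limit is in the hull of [S]
      plus [rec_cone K], and absorption applies ([closed_convex_hull]).

    Necessity.  Suppose that [u], but not [- u], is in [rec_cone L] and that [L]
    is not a halfspace.  The complement of the interior of [L] is then not
    convex ([not_halfspace_chord]).  A chord and the direction [u] yield a
    boundary point [p] of [L] above which the interior of [L] begins, and a
    point [q] outside this interior such that the line through [q] along [u]
    misses the interior, or the segment from [p] to [q] meets it.  The half-plane
    bounded by the line through [p] along [u] and containing [q] is mapped by
    [RL L] to a set that is not closed ([half_plane_not_closed]): its upper
    boundary is approached but not attained. *)

(** * Convex sets and their interiors *)

Section Convex.
Variables (R : realType) (E : normedModType R).
Implicit Types (A K L : set E) (x y z u v r : E) (t : R).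

Lemma convex_segP A : @convex_set R E A <->
  forall x y t, 0 <= t <= 1 -> A x -> A y -> A (t *: x + (1 - t) *: y).
Proof.
split=> [cA x y t /andP[t0 t1] Ax Ay | cA x y l].
  by have := cA x y (Itv01 t0 t1); rewrite !inE; exact.
rewrite !inE => Ax Ay; apply: cA => //.
by apply/andP; split; [exact: ge0|exact: le1].
Qed.

Lemma convex_setI A K :
  @convex_set R E A -> @convex_set R E K -> @convex_set R E (A `&` K).
Proof.
move=> /convex_segP cA /convex_segP cK; apply/convex_segP=> x y t t01 [? ?] [? ?].
by split; [exact: cA|exact: cK].
Qed.

Lemma convex_sum A n (w : 'I_n -> R) (p : 'I_n -> E) :
  @convex_set R E A -> (forall i, 0 <= w i) -> \sum_i w i = 1 ->
  (forall i, A (p i)) -> A (\sum_i w i *: p i).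
Proof.
move=> /convex_segP cA; elim: n => [|n IH] in w p *.
  by move=> _; rewrite big_ord0 => /eqP; rewrite eq_sym oner_eq0.
move=> w0; rewrite !big_ord_recl => w1 Ap.
set s := \sum_(i < n) w (lift ord0 i) in w1.
have s0 : 0 <= s by apply: sumr_ge0.
have Es : w ord0 = 1 - s by rewrite -w1 addrK.
have [s_eq0|sN0] := eqVneq s 0.
  have w_eq0 i : w (lift ord0 i) = 0 by exact: (psumr_eq0P _ s_eq0).
  rewrite Es s_eq0 subr0 scale1r big1 ?addr0// => i _; by rewrite w_eq0 scale0r.
have -> : \sum_(i < n) w (lift ord0 i) *: p (lift ord0 i) =
  s *: \sum_(i < n) (w (lift ord0 i) / s) *: p (lift ord0 i).
  by rewrite scaler_sumr; apply: eq_bigr => i _; rewrite scalerA mulrC mulfVK.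
rewrite addrC Es; apply: cA => //.
- by rewrite s0 /= -subr_ge0 -Es.
- apply: IH => [i||i] //; first by rewrite divr_ge0.
  by rewrite -mulr_suml divff.
Qed.

(** A homothety centred at [y] carries a neighbourhood of [x] that lies in [L] onto
    a neighbourhood of the new point. *)
Lemma interior_segment L x y t : @convex_set R E L ->
  0 < t <= 1 -> L° x -> L y -> L° (t *: x + (1 - t) *: y).
Proof.
move=> /convex_segP cL /andP[t0 t1] Lx Ly.
have cf : t^-1 *: (z - (1 - t) *: y) @[z --> t *: x + (1 - t) *: y] --> x.
  have -> : nbhs x = nbhs (t^-1 *: ((t *: x + (1 - t) *: y) - (1 - t) *: y)).
    by rewrite addrK scalerA mulVf ?gt_eqF// scale1r.
  by apply: cvgZ; [exact: cvg_cst|apply: cvgB; [exact: cvg_id|exact: cvg_cst]].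
have {}cf : \forall z \near t *: x + (1 - t) *: y, L (t^-1 *: (z - (1 - t) *: y)).
  exact: cf _ Lx.
apply: filterS cf => z Lz.
have -> : z = t *: (t^-1 *: (z - (1 - t) *: y)) + (1 - t) *: y.
  by rewrite scalerA divff ?gt_eqF// scale1r subrK.
by apply: cL => //; rewrite ltW.
Qed.

Lemma interior_shift L x u : (forall y, L y -> L (y + u)) -> L° x -> L° (x + u).
Proof.
move=> Lu Lx.
have cf : z - u @[z --> x + u] --> x.
  rewrite -[X in _ --> X](addrK u x).
  by apply: cvgB; [exact: cvg_id|exact: cvg_cst].
have {}cf : \forall z \near x + u, L (z - u) by exact: cf _ Lx.
by apply: filterS cf => z /Lu; rewrite subrK.
Qed.

Lemma interior_line x u L : L° x -> \forall t \near (0 : R), L° (x + t *: u).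
Proof.
move=> Lx; have Lo : nbhs x L° by apply: open_nbhs_nbhs; split => //; exact: open_interior.
have cf : x + t *: u @[t --> (0:R)] --> x.
  rewrite -[X in _ --> X]addr0 -[X in _ --> _ + X](scale0r u).
  by apply: cvgD; [exact: cvg_cst|apply: cvgZr_tmp; exact: cvg_id].
exact: cf _ Lo.
Qed.

Lemma closed_line K x u : closed K -> closed [set t : R | K (x + t *: u)].
Proof.
move=> cK; apply: preimage_closed => // t _.
by apply: cvgD; [exact: cvg_cst|apply: cvgZr_tmp; exact: cvg_id].
Qed.
End Convex.

(** * Convex hulls and recession cones *)

Section HullRec.
Variables (R : realType) (d : nat).
Local Notation E := 'rV[R]_d.
Implicit Types (A B K L : set E) (x y z u v r : E) (t : R).

Lemma hull_convex A : @convex_set R E (convex_hull A).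
Proof.
apply/convex_segP => x y t t01 hx hy B [cB AB].
by move/convex_segP : (cB); apply => //; [exact: hx|exact: hy].
Qed.

Lemma sub_hull A : A `<=` convex_hull A.
Proof. exact: sub_gen_smallest. Qed.

Lemma hull_min A B : @convex_set R E B -> A `<=` B -> convex_hull A `<=` B.
Proof. by move=> cB AB; exact: smallest_sub. Qed.

Lemma hull_mono A B : A `<=` B -> convex_hull A `<=` convex_hull B.
Proof.
by move=> AB; apply: hull_min; [exact: hull_convex|move=> x /AB /sub_hull].
Qed.

Lemma hull_id A : @convex_set R E A -> convex_hull A = A.
Proof. by move=> cA; apply/seteqP; split; [exact: hull_min|exact: sub_hull]. Qed.

Lemma hull_shift A u : (forall x, A x -> convex_hull A (x + u)) ->
  forall x, convex_hull A x -> convex_hull A (x + u).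
Proof.
move=> Au; apply: hull_min => //; apply/convex_segP => x y t t01 /= hx hy.
have -> : t *: x + (1 - t) *: y + u = t *: (x + u) + (1 - t) *: (y + u).
  by rewrite !scalerDr addrACA -scalerDl [t + _]addrC subrK scale1r.
by move/convex_segP : (@hull_convex A); exact.
Qed.

Lemma rec_coneD K u v : rec_cone K u -> rec_cone K v -> rec_cone K (u + v).
Proof.
by move=> Ku Kv x Kx t t0; rewrite scalerDr addrA; apply: Kv => //; exact: Ku.
Qed.

Lemma rec_coneZ K u t : 0 <= t -> rec_cone K u -> rec_cone K (t *: u).
Proof.
by move=> t0 Ku x Kx s s0; rewrite scalerA; apply: Ku => //; rewrite mulr_ge0.
Qed.

Lemma rec_cone0 K : rec_cone K 0.
Proof. by move=> x Kx t _; rewrite scaler0 addr0. Qed.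

Lemma rec_cone1 K x u : rec_cone K u -> K x -> K (x + u).
Proof. by move=> Ku Kx; rewrite -[u]scale1r; exact: Ku. Qed.

Lemma rec_cone_sum K (I : Type) (s : seq I) (P : pred I) (F : I -> E) :
  (forall i, P i -> rec_cone K (F i)) -> rec_cone K (\sum_(i <- s | P i) F i).
Proof.
by move=> KF; elim/big_ind : _ => //; [exact: rec_cone0|exact: rec_coneD].
Qed.

(** For [x] in [K] the points [(1 - t * mu n) x + t * mu n * z n] of [K] tend to
    [x + t r].  This is how limits of unbounded points of [K] are used. *)
Lemma rec_cone_lim K (T : Type) (F : set_system T) (mu : T -> R) (z : T -> E) r :
  ProperFilter F -> closed K -> @convex_set R E K ->
  (\forall n \near F, 0 <= mu n) -> (\forall n \near F, K (z n)) ->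
  mu n @[n --> F] --> 0 -> mu n *: z n @[n --> F] --> r -> rec_cone K r.
Proof.
move=> FF cK /convex_segP kK mu0 Kz cmu cz x Kx t t0.
have c1 : (t * mu n) *: z n + (1 - t * mu n) *: x @[n --> F] --> t *: r + (1 - t * 0) *: x.
  apply: cvgD.
    under eq_fun do rewrite -scalerA.
    by apply: cvgZ => //; exact: cvg_cst.
  apply: cvgZr_tmp; apply: cvgB; first exact: cvg_cst.
  by apply: cvgM => //; exact: cvg_cst.
rewrite mulr0 subr0 scale1r addrC in c1.
apply: (closed_cvg _ cK _ _ c1).
have ct : t * mu n @[n --> F] --> 0.
  by rewrite -(mulr0 t); apply: cvgM => //; exact: cvg_cst.
have t1 : \forall n \near F, t * mu n < 1 by apply: (cvgr_lt 0).
near=> n; apply: kK => //; last by near: n.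
rewrite mulr_ge0//=; last by near: n.
by rewrite ltW//; near: n.
Unshelve. all: by end_near. Qed.

(** A closed convex set that contains one ray along [u] contains the rays along
    [u] from all its points, so any other direction finally leaves [L], from
    every starting point. *)
Lemma ray_exit L x u : closed L -> @convex_set R E L -> ~ rec_cone L u ->
  exists2 t, 0 <= t & ~ L (x + t *: u).
Proof.
move=> cL kL nu; apply: contrapT => hx; apply: nu.
have Lx t : 0 <= t -> L (x + t *: u).
  by move=> t0; apply: contrapT => nL; apply: hx; exists t.
apply: (@rec_cone_lim L nat \oo (@harmonic R) (fun n => x + (n.+1%:R) *: u)) => //.
- by near=> n; apply: harmonic_ge0.
- by near=> n; apply: Lx.
- exact: cvg_harmonic.
have -> : (fun n => @harmonic R n *: (x + (n.+1%:R) *: u)) = (fun n => @harmonic R n *: x + u).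
  apply/funext => n; rewrite scalerDr scalerA /harmonic mulVf ?scale1r//.
have : @harmonic R n *: x + u @[n --> \oo] --> 0 *: x + u.
  by apply: cvgD; [apply: cvgZr_tmp; exact: cvg_harmonic|exact: cvg_cst].
by rewrite scale0r add0r.
Unshelve. all: by end_near. Qed.

Lemma interior_rec L x u : rec_cone L u -> L° x -> L° (x + u).
Proof. by move=> Lu; apply: interior_shift => y Ly; exact: rec_cone1. Qed.

(** In finite dimension, a subspace of maximal dimension among those contained
    in [A] must be [A]. *)
Lemma subspaceP A : A 0 -> (forall u v, A u -> A v -> A (u + v)) ->
  (forall t u, A u -> A (t *: u)) -> is_linear_space A.
Proof.
move=> A0 AD AZ.
pose P k := `[< exists2 U : {vspace E}, \dim U = k & [set` U] `<=` A >].
have P0 : exists k, P k.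
  exists 0; apply/asboolP; exists 0%VS; first by rewrite dimv0.
  by move=> u /=; rewrite memv0 => /eqP ->.
have Pub k : P k -> (k <= \dim {:E})%N.
  by move=> /asboolP[U <- _]; rewrite dimvS ?subvf.
case: (ex_maxnP P0 Pub) => k /asboolP[U dU UA] kmax.
exists U; apply/seteqP; split => // u Au; apply: contrapT => /negP uU.
have : P (\dim (U + <[u]>)%VS).
  apply/asboolP; exists (U + <[u]>)%VS => // w /= /memv_addP[a aU [b /vlineP[c ->] ->]].
  by apply: AD; [exact: UA|exact: AZ].
move=> /kmax; rewrite -dU leqNgt => /negP; apply.
rewrite ltn_neqAle dimvS ?addvSl// andbT.
apply/eqP => /eqP; rewrite eqn_leq => /andP[_ hd].
have := eqEdim U (U + <[u]>); rewrite addvSl hd /= => /eqP UE.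
by move: uU; rewrite UE memvE (addvSr U <[u]>).
Qed.
End HullRec.

(** * Inner product and supporting hyperplanes *)

(** Ultrafilters replace the extraction of subsequences, for any number of
    functions at once. *)
Lemma ultra_compact_cvg (T : Type) (X : topologicalType) (U : set_system T)
  (f : T -> X) (A : set X) : UltraFilter U -> compact A ->
  (\forall n \near U, A (f n)) -> exists2 p, A p & f n @[n --> U] --> p.
Proof.
move=> UU cA UA; have PU := @ultra_proper _ _ UU.
have [p [Ap clp]] := cA _ (fmap_proper_filter f PU) UA.
exists p => // B pB; have [//|UnB] := in_ultra_setVsetC (f @^-1` B) UU.
have [q [qn qB]] := clp (~` B) B UnB pB; by [].
Qed.

Lemma cvg_bigsum (R : realType) (V : normedModType R) (T I : Type)
  (F : set_system T) (s : seq I) (f : I -> T -> V) (l : I -> V) : Filter F ->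
  (forall i, f i n @[n --> F] --> l i) ->
  \sum_(i <- s) f i n @[n --> F] --> \sum_(i <- s) l i.
Proof.
move=> FF fl; elim: s => [|i s IH].
  under eq_fun do rewrite big_nil.
  by rewrite big_nil; exact: cvg_cst.
under eq_fun do rewrite big_cons.
by rewrite big_cons; exact: cvgD.
Qed.

Section Dot.
Variables (R : realType) (d : nat).
Local Notation E := 'rV[R]_d.
Implicit Types (A B K L : set E) (a b x y z u v r w : E) (t : R).

Definition dot a x : R := \sum_(i < d) a 0 i * x 0 i.

Lemma dotC a x : dot a x = dot x a.
Proof. by apply: eq_bigr => i _; rewrite mulrC. Qed.

Lemma dotDr a x y : dot a (x + y) = dot a x + dot a y.
Proof. by rewrite -big_split; apply: eq_bigr => i _; rewrite mxE mulrDr. Qed.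

Lemma dotZr a t x : dot a (t *: x) = t * dot a x.
Proof. by rewrite mulr_sumr; apply: eq_bigr => i _; rewrite mxE mulrCA. Qed.

Lemma dotNr a x : dot a (- x) = - dot a x.
Proof. by rewrite -scaleN1r dotZr mulN1r. Qed.

Lemma dotBr a x y : dot a (x - y) = dot a x - dot a y.
Proof. by rewrite dotDr dotNr. Qed.

Lemma dot0r a : dot a 0 = 0.
Proof. by rewrite -(scale0r 0) dotZr mul0r. Qed.

Lemma dotDl a b x : dot (a + b) x = dot a x + dot b x.
Proof. by rewrite dotC dotDr !(dotC x). Qed.

Lemma dotZl t a x : dot (t *: a) x = t * dot a x.
Proof. by rewrite dotC dotZr dotC. Qed.

Lemma dotNl a x : dot (- a) x = - dot a x.
Proof. by rewrite dotC dotNr dotC. Qed.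

Lemma dot0l x : dot 0 x = 0.
Proof. by rewrite dotC dot0r. Qed.

Lemma dot_sqrD w v t : dot (w + t *: v) (w + t *: v) =
  dot w w + 2 * t * dot w v + t * (t * dot v v).
Proof. by rewrite dotDl !dotDr !dotZl !dotZr (dotC v w); ring. Qed.

Lemma normr_dot w : `|w| ^+ 2 <= dot w w.
Proof.
have w0 i : 0 <= w 0 i * w 0 i by rewrite -expr2 sqr_ge0.
have [->|wN0] := eqVneq `|w| 0; first by rewrite expr0n /= sumr_ge0.
have [[i j] wij] : exists ij, `|w| = `|w ij.1 ij.2| by exact: mx_norm_neq0.
rewrite wij /= ord1 -normrX ger0_norm ?sqr_ge0//.
by rewrite /dot (bigD1 j)//= expr2 lerDl sumr_ge0.
Qed.

Lemma dot_gt0 w : w != 0 -> 0 < dot w w.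
Proof.
by move=> w0; apply: lt_le_trans (normr_dot w); rewrite exprn_gt0 ?normr_gt0.
Qed.

Lemma cvg_dot (T : Type) (F : set_system T) (f g : T -> E) a x : Filter F ->
  f n @[n --> F] --> a -> g n @[n --> F] --> x ->
  dot (f n) (g n) @[n --> F] --> dot a x.
Proof.
move=> FF fa gx; apply: (@cvg_bigsum R R^o) => i; apply: cvgM.
  by apply: (continuous_cvg FF (h := fun M : E => M 0 i)) => //; exact: coord_continuous.
by apply: (continuous_cvg FF (h := fun M : E => M 0 i)) => //; exact: coord_continuous.
Qed.

Lemma dot_continuous a : continuous (dot a).
Proof.
move=> x; apply: (@cvg_dot E (nbhs x) (fun=> a) id) => //.
by apply: cvg_cst; exact: nbhs_filter.
Qed.

Lemma closed_dot_le a t : closed [set x | dot a x <= t].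
Proof.
apply: (preimage_closed (f := (dot a)) (D := [set s | s <= t])); last exact: closed_le.
by move=> x _; exact: dot_continuous.
Qed.

Lemma nearest_point L x : closed L -> L !=set0 ->
  exists2 y, L y & forall z, L z -> dot (y - x) (y - x) <= dot (z - x) (z - x).
Proof.
move=> cL [y0 Ly0]; pose f y := dot (y - x) (y - x).
have cf : continuous f.
  move=> y; have FN := @nbhs_filter E y.
  have cB : z - x @[z --> y] --> y - x.
    exact: (@cvgB _ _ _ (nbhs y) FN id (fun=> x) y x (@cvg_id _ _) (@cvg_cst _ _ _ _ FN)).
  exact: (@cvg_dot E (nbhs y) (fun z => z - x) (fun z => z - x)).
pose A := L `&` [set y | f y <= f y0].
have cA : compact A.
  apply: bounded_closed_compact; last first.
    apply: closedI => //; apply: (preimage_closed (f := f) (D := [set s | s <= f y0])).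
      by move=> y _; exact: cf.
    exact: closed_le.
  exists (`|x| + (1 + f y0)); split; first by rewrite num_real.
  move=> M hM y [_ /= yA]; apply: le_trans (ltW hM).
  rewrite -lerBlDl; apply: le_trans (lerB_dist _ _) _.
  have := le_trans (normr_dot (y - x)) yA; set c := `|y - x| => c2.
  have c0 : 0 <= c by rewrite normr_ge0.
  nra.
have [|||y Ly ymin] := @compact_EVT_min _ _ f A.
- by exists y0; split => //=.
- exact: cA.
- by apply: continuous_subspaceT; exact: cf.
exists y; first by move: Ly; rewrite inE => -[].
move=> z Lz; have [zA|zA] := leP (f z) (f y0); last first.
  apply: le_trans (ltW zA); apply: ymin; rewrite inE; split => //=.
by apply: ymin; rewrite inE.
Qed.

(** The normal vector joins [x] to its nearest point in [L], and is normalised so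
    that it stays in a compact set when [x] varies. *)
Lemma separation L x : closed L -> @convex_set R E L -> L !=set0 -> ~ L x ->
  exists2 a, `|a| = 1 & forall y, L y -> dot a y <= dot a x.
Proof.
move=> cL /convex_segP kL L0 nLx; have [y0 Ly0 ymin] := nearest_point x cL L0.
pose w := y0 - x.
have wN0 : w != 0 by rewrite subr_eq0; apply/eqP => yx; apply: nLx; rewrite -yx.
have key y : L y -> 0 <= dot w (y - y0).
  move=> Ly; rewrite leNgt; apply/negP => neg.
  pose c := - dot w (y - y0); have c0 : 0 < c by rewrite oppr_gt0.
  pose V := dot (y - y0) (y - y0).
  have V0 : 0 <= V by apply: le_trans (normr_dot _); rewrite exprn_ge0.
  pose t := c / (c + V); have cV : 0 < c + V by rewrite ltr_wpDr.
  have t0 : 0 < t by rewrite divr_gt0.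
  have t1 : t <= 1 by rewrite ler_pdivrMr// mul1r lerDl.
  have tV : t * V <= c.
    by rewrite /t mulrAC ler_pdivrMr// ler_pM2l// lerDr ltW.
  have Lz : L (t *: y + (1 - t) *: y0) by apply: kL => //; rewrite t1 ltW.
  have := ymin _ Lz.
  have -> : t *: y + (1 - t) *: y0 - x = w + t *: (y - y0).
    by apply/rowP => i; rewrite !mxE; ring.
  rewrite dot_sqrD -/V -[dot w (y - y0)]opprK -/c.
  have tc : 0 < t * c by rewrite mulr_gt0.
  have ttV : t * (t * V) <= t * c by rewrite ler_pM2l.
  rewrite -/w; lra.
exists (- `|w|^-1 *: w).
  by rewrite normrZ normrN normfV normr_id mulVf// normr_eq0.
move=> y Ly; rewrite !dotZl !mulNr lerN2 ler_pM2l ?invr_gt0 ?normr_gt0//.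
have := key _ Ly; rewrite dotBr subr_ge0; apply: le_trans.
by rewrite -subr_ge0 -dotBr ltW// dot_gt0.
Qed.

Lemma compact_unit_sphere : compact [set a : E | `|a| = 1].
Proof.
apply: bounded_closed_compact.
  by exists 1; split => [|M M1 a /= ->]; [rewrite num_real|rewrite ltW].
apply: (preimage_closed (f := (fun a : E => `|a|)) (D := [set 1])); last exact: closed_eq.
by move=> x _; exact: norm_continuous.
Qed.

(** The normals that separate [L] from points outside [L] tending to [x]
    accumulate, by compactness of the sphere, at a normal of [L] at [x]. *)
Lemma supporting_hyperplane L x : closed L -> @convex_set R E L ->
  L° !=set0 -> ~ L° x -> exists a, forall y, L° y -> dot a y < dot a x.
Proof.
move=> cL kL [c Lc] nLx; have L0 : L !=set0 by exists c; exact: interior_subset.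
have /choice[a aP] z : exists a, ~ L z -> `|a| = 1 /\ forall y, L y -> dot a y <= dot a z.
  have [Lz|nLz] := pselect (L z); first by exists 0.
  by have [a a1 aL] := separation cL kL L0 nLz; exists a.
pose F := within (~` L) (nbhs x).
have PF : ProperFilter F.
  apply: Build_ProperFilter => F0; apply: nLx.
  have {}F0 : \forall z \near x, (~` L) z -> set0 z by exact: F0.
  by apply: filterS F0 => z h; apply: contrapT => /h.
have [U [UU FU]] := ultraFilterLemma PF.
have PU := @ultra_proper _ _ UU.
have UnL : \forall z \near U, ~ L z by apply: FU; exact: withinT.
have Ux : z @[z --> U] --> x by move=> B xB; apply: FU; exact: cvg_within xB.
have [|p p1 ap] := ultra_compact_cvg (f := a) UU compact_unit_sphere.
  by apply: filterS UnL => z /aP[].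
have pL y : L y -> dot p y <= dot p x.
  move=> Ly; rewrite -subr_ge0 -dotBr.
  apply: (closed_cvg (FF := PU) (fun s : R => 0 <= s) (@closed_ge _ _)
    (u_ := fun z => dot (a z) (z - y))); last first.
    apply: (@cvg_dot _ U a (fun z => z - y)) => //.
    by apply: cvgB; [exact: Ux|exact: cvg_cst].
  by apply: filterS UnL => z /aP[_ /(_ _ Ly)]; rewrite dotBr subr_ge0.
exists p; move=> y Ly.
have p0 : p != 0 by rewrite -normr_gt0 p1 ltr01.
have [t [t0 Lt]] : exists t, 0 < t /\ L (y + t *: p).
  have := interior_line p Ly => /nbhs_ballP[e /= e0 he].
  exists (e / 2); split; first by rewrite divr_gt0.
  apply: interior_subset; apply: he; rewrite -ball_normE /= sub0r normrN.
  by rewrite ger0_norm ?divr_ge0 ?ltW// ltr_pdivrMr// mulr_natr mulr2n ltrDl.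
apply: lt_le_trans (pL _ Lt); rewrite dotDr dotZr ltrDl mulr_gt0//.
exact: dot_gt0.
Qed.
End Dot.

(** * Sets of full dimension *)

Section Dimension.
Variables (R : realType) (d : nat).
Local Notation E := 'rV[R]_d.
Implicit Types (A B K L : set E) (a b x y z u v r w : E) (t : R).

Lemma rV_linear_continuous (F : normedModType R) (f : {linear E -> F}) :
  continuous (f : E -> F).
Proof.
have -> : (f : E -> F) = fun x => \sum_(i < d) x 0 i *: f 'e_i.
  apply/funext => x; rewrite [in LHS](row_sum_delta x) linear_sum.
  by apply: eq_bigr => i _; rewrite linearZ.
move=> x; have FN := @nbhs_filter E x.
apply: (cvg_bigsum (F := nbhs x) (f := fun i z => z 0 i *: f 'e_i)) => i.
by apply: cvgZr_tmp; exact: coord_continuous.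
Qed.

Lemma affine_hull_min A B : affine_set B -> A `<=` B -> affine_hull A `<=` B.
Proof. by move=> aB AB; exact: smallest_sub. Qed.

(** A maximal free family of vectors [v] with [x0 + v] in [L] spans the direction
    of the affine hull, hence the whole space; the barycentre of the resulting
    simplex is interior because the barycentric coordinates are continuous. *)
Lemma full_dim_interior L : @convex_set R E L -> has_dim L d -> L° !=set0.
Proof.
move=> kL [p [V [LV dV]]].
have [x0 Lx0] : L !=set0.
  apply: contrapT => L0; have : affine_hull L p.
    by rewrite LV; exists 0; rewrite ?addr0//= mem0v.
  move=> /(_ set0); apply; split; first by move=> ? ? ? [].
  by move=> x Lx; apply: L0; exists x.
pose P k := `[< exists s : seq E, [/\ size s = k, free s & forall v, v \in s -> L (x0 + v)] >].
have P0 : exists k, P k by exists 0; apply/asboolP; exists [::]; rewrite nil_free.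
have Pub k : P k -> (k <= \dim {:E})%N.
  by move=> /asboolP[s [<- /eqP <- _]]; rewrite dimvS ?subvf.
case: (ex_maxnP P0 Pub) => k /asboolP[s [sk fs sL]] kmax.
have Ls x : L x -> x - x0 \in <<s>>%VS.
  move=> Lx; apply: contrapT => /negP xs.
  have : P k.+1.
    apply/asboolP; exists ((x - x0) :: s); split; first by rewrite /= sk.
      by rewrite free_cons xs.
    by move=> v; rewrite inE => /orP[/eqP->|/sL//]; rewrite addrC subrK.
  by move=> /kmax; rewrite ltnn.
have affs : affine_hull L `<=` [set x | x - x0 \in <<s>>%VS].
  apply: affine_hull_min => // x y t /= xs ys.
  have -> : (1 - t) *: x + t *: y - x0 = (1 - t) *: (x - x0) + t *: (y - x0).
    by apply/rowP => i; rewrite !mxE; ring.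
  by rewrite memvD// memvZ.
have Vs : (V <= <<s>>)%VS.
  apply/subvP => v vV.
  have h1 : p + v - x0 \in <<s>>%VS by apply: affs; rewrite LV; exists v.
  have h2 : p - x0 \in <<s>>%VS.
    by apply: affs; rewrite LV; exists 0; rewrite ?addr0//= mem0v.
  have -> : v = (p + v - x0) - (p - x0) by apply/rowP => i; rewrite !mxE; ring.
  by rewrite memvB.
have sfull : <<s>>%VS = fullv.
  apply/eqP; rewrite eqEdim subvf /=; apply: leq_trans (dimvS Vs).
  by rewrite dV dimvf /dim /= mul1n.
pose n := size s; pose X := in_tuple s.
pose kap i : {linear E -> R^o} := @coord _ _ n X i.
pose c := x0 + \sum_(i < n) (n.+1%:R^-1 : R) *: s`_i.
have nR : 0 < (n.+1%:R^-1 : R) by rewrite invr_gt0.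
have kapc i : kap i (c - x0) = n.+1%:R^-1.
  rewrite /c addrC addKr /kap.
  exact: (@coord_sum_free _ _ n X (fun=> n.+1%:R^-1) i fs).
have ckap i : (kap i (y - x0) : R) @[y --> c] --> (kap i (c - x0) : R).
  have FN := @nbhs_filter E c.
  apply: (continuous_cvg FN (h := kap i : E -> R^o)).
    exact: rV_linear_continuous.
  exact: (@cvgB _ _ _ (nbhs c) FN id (fun=> x0) c x0 (@cvg_id _ _) (@cvg_cst _ _ _ _ FN)).
have csum : \sum_(i < n) (kap i (y - x0) : R) @[y --> c] --> \sum_(i < n) (kap i (c - x0) : R).
  have FN := @nbhs_filter E c.
  exact: (@cvg_bigsum R R^o).
have sumc : \sum_(i < n) (kap i (c - x0) : R) < 1.
  rewrite (eq_bigr (fun=> n.+1%:R^-1)) => [|i _]; last exact: kapc.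
  rewrite sumr_const card_ord -(mulr_natl _ n) -[ltLHS]/(n%:R / n.+1%:R : R).
  by rewrite ltr_pdivrMr// mul1r ltr_nat.
exists c.
have h1 : \forall y \near c, forall i, 0 < (kap i (y - x0) : R).
  apply: (@filter_forall _ _ _ (nbhs c)) => i; apply: (cvgr_gt _ (ckap i)).
  by rewrite kapc.
have h2 : \forall y \near c, \sum_(i < n) (kap i (y - x0) : R) < 1.
  exact: (cvgr_lt _ csum).
apply: filterS2 h1 h2 => y y0 y1.
have -> : y = \sum_(i < n.+1)
    (oapp (fun j : 'I_n => kap j (y - x0) : R)
       (1 - \sum_(i < n) (kap i (y - x0) : R)) (unlift ord0 i)) *:
    (x0 + oapp (fun j : 'I_n => s`_j) 0 (unlift ord0 i)).
  rewrite big_ord_recl unlift_none /= addr0.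
  rewrite (eq_bigr (fun i : 'I_n =>
    (kap i (y - x0) : R) *: x0 + (kap i (y - x0) : R) *: s`_i)); last first.
    by move=> i _; rewrite (liftK (ord0 : 'I_n.+1) i) /= scalerDr.
  rewrite big_split /= -scaler_suml.
  have := coord_span (v := y - x0) (X := X); rewrite sfull memvf => /(_ isT).
  by move=> E1; rewrite addrA -scalerDl subrK scale1r -E1 addrC subrK.
apply: convex_sum => //.
- move=> i; case: unliftP => [j _|_] /=; first exact: ltW (y0 j).
  by rewrite subr_ge0; exact: ltW.
- rewrite big_ord_recl unlift_none /=.
  rewrite [X in _ + X = _](eq_bigr (fun i : 'I_n => (kap i (y - x0) : R))); first exact: subrK.
  by move=> i _; rewrite (liftK (ord0 : 'I_n.+1) i).
- move=> i; case: unliftP => [j _|_] /=; last by rewrite addr0.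
  by apply: sL; rewrite mem_nth.
Qed.
End Dimension.

(** * Polyhedra and Fourier-Motzkin elimination *)

(** Finitely many lower bounds lying below finitely many upper bounds leave room
    for a common point; this is what makes the elimination of a variable exact. *)
Lemma exists_between (R : realDomainType) (A B : seq R) :
  (forall a b, a \in A -> b \in B -> a <= b) ->
  exists t, (forall a, a \in A -> a <= t) /\ (forall b, b \in B -> t <= b).
Proof.
elim: A => [_|a A IH AB].
  elim: B => [|b B [t [_ tB]]]; first by exists 0.
  exists (Num.min b t); split => // c; rewrite inE => /orP[/eqP->|/tB tc].
    by rewrite ge_min lexx.
  by rewrite ge_min tc orbT.
have [|t [tA tB]] := IH; first by move=> c b cA; apply: AB; rewrite inE cA orbT.
exists (Num.max a t); split => c.
  by rewrite inE => /orP[/eqP->|/tA ct]; rewrite le_max ?lexx// ct orbT.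
by move=> cB; rewrite ge_max tB// AB// inE eqxx.
Qed.

Section Polyhedra.
Variables (R : realType) (d : nat).
Local Notation E := 'rV[R]_d.
Implicit Types (A B K L P : set E) (a b x y z u v r w : E) (t h : R).

Lemma polyhedronT : polyhedron (setT : set E).
Proof.
exists 0, (fun=> setT); split; first by case.
by apply/seteqP; split => // x _ [].
Qed.

Lemma polyhedronI P Q : polyhedron P -> polyhedron Q -> polyhedron (P `&` Q).
Proof.
move=> [n [H [Hh ->]]] [m [K [Kh ->]]].
exists (n + m)%N, (fun i => match fintype.split i with inl j => H j | inr k => K k end).
split; first by move=> i; case: (fintype.split i).
apply/seteqP; split => [x [xH xK] i _|x xHK].
  by case: (fintype.split i) => j; [exact: xH|exact: xK].
split => j _.
  by have := xHK (lshift m j) I; rewrite (unsplitK (inl j)).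
by have := xHK (rshift n j) I; rewrite (unsplitK (inr j)).
Qed.

(** The vector [a] may vanish here: the set is then the whole space, or it is
    empty and thus the intersection of two opposite halfspaces. *)
Lemma polyhedron_le a t : (0 < d)%N -> polyhedron [set x | dot a x <= t].
Proof.
have halfspace c s : c != 0 -> polyhedron [set x | dot c x <= s].
  move=> cN0; exists 1, (fun=> [set x | dot c x <= s]); split.
    by move=> _; exists c, s.
  by apply/seteqP; split => [x xs i _|x /(_ ord0 I)].
move=> hd; pose i0 := Ordinal hd.
have [->|aN0] := eqVneq a 0; last exact: halfspace.
have [t0|t0] := leP 0 t.
  rewrite (_ : [set _ | _] = setT); first exact: polyhedronT.
  by apply/seteqP; split => x //= _; rewrite dot0l.
pose e : E := 'e_i0.
have eN0 : e != 0.
  by apply/eqP => /rowP/(_ i0); rewrite !mxE !eqxx /= => /eqP; rewrite oner_eq0.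
rewrite (_ : [set _ | _] = [set x | dot e x <= 0] `&` [set x | dot (- e) x <= -1]).
  by apply: polyhedronI; apply: halfspace; rewrite ?oppr_eq0.
apply/seteqP; split => x /=; rewrite dot0l.
  by move=> h; have := le_lt_trans h t0; rewrite ltxx.
by rewrite dotNl => -[]; set s := dot e x => h1 h2; exfalso; lra.
Qed.

Lemma polyhedron_system (l : seq (E * R)) : (0 < d)%N ->
  polyhedron [set x | forall c, c \in l -> dot c.1 x <= c.2].
Proof.
move=> hd; elim: l => [|c l IH].
  rewrite (_ : [set _ | _] = setT); first exact: polyhedronT.
  by apply/seteqP; split.
rewrite (_ : [set _ | _] =
    [set x | dot c.1 x <= c.2] `&` [set x | forall c, c \in l -> dot c.1 x <= c.2]).
  by apply: polyhedronI => //; exact: polyhedron_le.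
apply/seteqP; split => [x xl|x [xc xl] e].
  by split => [|e el] /=; apply: xl; rewrite inE ?eqxx// el orbT.
by rewrite inE => /orP[/eqP->|/xl].
Qed.

Lemma polyhedron_inequalities P : polyhedron P ->
  exists n (a : 'I_n -> E) (b : 'I_n -> R),
    P = [set x | forall i, dot (a i) x <= b i].
Proof.
move=> [n [H [/choice[a /choice[b Hab]] ->]]]; exists n, a, b.
apply/seteqP; split => x xH i; last by move=> _; have [_ ->] := Hab i; exact: xH.
by have := xH i I; have [_ ->] := Hab i.
Qed.

Lemma polyhedron_closed P : polyhedron P -> closed P.
Proof.
move=> /polyhedron_inequalities[n [a [b ->]]].
rewrite (_ : [set _ | _] = \bigcap_(i in [set: 'I_n]) [set x | dot (a i) x <= b i]).
  by apply: closed_bigI => i _; exact: closed_dot_le.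
by apply/seteqP; split => [x xi i _|x xi i]; [exact: xi|exact: (xi i I)].
Qed.

Lemma polyhedron_convex P : polyhedron P -> @convex_set R E P.
Proof.
move=> /polyhedron_inequalities[n [a [b ->]]]; apply/convex_segP.
move=> x y t /andP[t0 t1] xP yP i; rewrite dotDr !dotZr.
rewrite (_ : b i = t * b i + (1 - t) * b i); last by ring.
by rewrite lerD// ler_wpM2l// subr_ge0.
Qed.

(** The cone over the polyhedron [dot c.1 x <= c.2]; the polyhedron itself is its
    section at height [h = 1].  Homogenising treats points and directions alike. *)
Definition homogeneous_cone (G : seq (E * R)) x h :=
  forall c, c \in G -> dot c.1 x <= c.2 * h.

(** Fourier-Motzkin elimination of [t].  A constraint [c] of [G] reads
    [al c <= t * gam c], which bounds [t] from below, from above or not at all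
    according to the sign of [gam c]; the constraint [0 <= t] is one more lower
    bound.  The new system compares each lower bound to each upper bound. *)
Lemma cone_add_generator (G : seq (E * R)) f (eta : R) : exists G' : seq (E * R),
  forall x h, homogeneous_cone G' x h <->
    exists2 t, 0 <= t & homogeneous_cone G (x - t *: f) (h - t * eta).
Proof.
pose gam (c : E * R) := dot c.1 f - c.2 * eta.
pose al (c : E * R) x h := dot c.1 x - c.2 * h.
have Gal x h t : homogeneous_cone G (x - t *: f) (h - t * eta) <->
    forall c, c \in G -> al c x h <= t * gam c.
  split=> H c /H; rewrite dotBr dotZr /al /gam.
    by move=> h1; lra.
  by move=> h1; lra.
pose comb (p : (E * R) * (E * R)) : E * R :=
  (gam p.1 *: p.2.1 - gam p.2 *: p.1.1, gam p.1 * p.2.2 - gam p.2 * p.1.2).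
have alcomb p x h : al (comb p) x h = gam p.1 * al p.2 x h - gam p.2 * al p.1 x h.
  by rewrite /al /comb /= dotDl dotNl !dotZl; ring.
pose G0 := [seq c <- G | gam c <= 0].
pose Gp := [seq c <- G | 0 < gam c].
pose Gn := [seq c <- G | gam c < 0].
exists (G0 ++ [seq comb p | p <- [seq (j, k) | j <- Gp, k <- Gn]]) => x h.
split=> [H|[t t0 /Gal H] c].
  have H' c : c \in G0 ++ [seq comb p | p <- [seq (j, k) | j <- Gp, k <- Gn]] ->
    al c x h <= 0 by move=> /H; rewrite /al subr_le0.
  pose lo := 0 :: [seq al c x h / gam c | c <- Gp].
  pose up := [seq al c x h / gam c | c <- Gn].
  have [|t [tlo tup]] := @exists_between _ lo up.
    move=> s1 s2 + /mapP[k kGn ->].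
    move: (kGn); rewrite mem_filter => /andP[k0 kG].
    have alk : al k x h <= 0.
      by apply: H'; rewrite mem_cat mem_filter kG ltW.
    rewrite inE => /orP[/eqP->|/mapP[j jGp ->]].
      by rewrite mulr_le0// invr_le0 ltW.
    move: (jGp); rewrite mem_filter => /andP[j0 jG].
    rewrite ler_pdivrMr// -mulrA mulrC -mulrA mulrC ler_ndivlMr// -subr_ge0.
    have : al (comb (j, k)) x h <= 0.
      apply: H'; rewrite mem_cat; apply/orP; right; apply: map_f.
      by apply/allpairsP; exists (j, k).
    by rewrite alcomb /= => q; lra.
  exists t; first by apply: tlo; rewrite inE eqxx.
  apply/Gal => c cG; case: (ltgtP (gam c) 0) => c0.
  - rewrite -ler_ndivlMr//; apply: tup; apply: map_f.
    by rewrite mem_filter c0.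
  - rewrite -ler_pdivrMr//; apply: tlo; rewrite inE; apply/orP; right; apply: map_f.
    by rewrite mem_filter c0.
  - by rewrite c0 mulr0; apply: H'; rewrite mem_cat mem_filter c0 lexx cG.
rewrite -subr_le0 -/(al c x h) mem_cat => /orP[|].
  rewrite mem_filter => /andP[c0 cG]; apply: le_trans (H _ cG) _.
  by rewrite mulr_ge0_le0.
move=> /mapP[p /allpairsP[[j k] [/= jGp kGn ->]] ->]; rewrite alcomb /=.
move: jGp kGn; rewrite !mem_filter => /andP[j0 jG] /andP[k0 kG].
have h1 : gam j * al k x h <= gam j * (t * gam k) by rewrite ler_pM2l// H.
have h2 : gam k * (t * gam j) <= gam k * al j x h by rewrite ler_nM2l// H.
lra.
Qed.

Lemma cone_add_generators (G : seq (E * R)) (F : seq (E * R)) : exists G' : seq (E * R),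
  forall x h, homogeneous_cone G' x h <->
    exists2 w : nat -> R, (forall i, 0 <= w i) & homogeneous_cone G
      (x - \sum_(i < size F) w i *: (nth 0 F i).1)
      (h - \sum_(i < size F) w i * (nth 0 F i).2).
Proof.
elim: F => [|f F [G1 HG1]].
  exists G => x h; split=> [H|[w _]]; last by rewrite !big_ord0 !subr0.
  by exists (fun=> 0) => //; rewrite !big_ord0 !subr0.
have [G' HG'] := cone_add_generator G1 f.1 f.2; exists G' => x h.
rewrite HG'; split=> [[t t0 /HG1[w w0 Gw]]|[w w0 Gw]].
  exists (fun i => if i is j.+1 then w j else t); first by case.
  by rewrite !big_ord_recl /= !opprD !addrA.
exists (w 0%N) => //; apply/HG1; exists (fun i => w i.+1) => //.
by move: Gw; rewrite !big_ord_recl /= !opprD !addrA.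
Qed.

(** The generators [(f, 1)] are points and the generators [(f, 0)] directions, so
    these are the sums of a convex hull, a finitely generated cone and a
    polyhedral cone. *)
Lemma polyhedron_generated (C : seq E) (F : seq (E * R)) : (0 < d)%N ->
  polyhedron [set x | exists w : nat -> R, [/\ forall i, 0 <= w i,
    \sum_(i < size F) w i * (nth 0 F i).2 = 1 &
    forall c, c \in C -> dot c (x - \sum_(i < size F) w i *: (nth 0 F i).1) <= 0]].
Proof.
move=> hd.
pose G0 : seq (E * R) := [:: (0, 1); (0, -1)] ++ [seq (c, 0) | c <- C].
have [G HG] := cone_add_generators G0 F.
rewrite (_ : [set _ | _] = [set x | forall c, c \in G -> dot c.1 x <= c.2]).
  exact: polyhedron_system.
apply/seteqP; split => x /=.
  move=> [w [w0 w1 wC]] c cG; rewrite -[leRHS]mulr1; move: c cG.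
  apply/HG; exists w => // c; rewrite w1 subrr mulr0 !inE.
  case/or3P => [/eqP->|/eqP->|/mapP[e eC ->]] /=; rewrite ?dot0l//.
  exact: wC.
move=> H; have /HG[w w0 Hw] : homogeneous_cone G x 1.
  by move=> c cG; rewrite mulr1; exact: H.
exists w; split => //.
  have := Hw (0, 1); have := Hw (0, -1); rewrite !inE !eqxx ?orbT /= !dot0l.
  move=> /(_ isT) h1 /(_ isT) h2.
  lra.
move=> c cC; have := Hw (c, 0); rewrite !inE map_f ?orbT//= mul0r; exact.
Qed.
End Polyhedra.

(** * A half-plane with non-closed image *)

(** With [closed_line], this passes from the inner points of a segment to its end. *)
Lemma closed_contains0 (R : realType) (T : set R) : closed T ->
  (forall e, 0 < e -> exists t, 0 <= t < e /\ T t) -> T 0.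
Proof.
move=> cT small; apply: cT => B /nbhs_ballP[e /= e0 eB].
have [t [/andP[t0 te] Tt]] := small e e0; exists t; split => //; apply: eB.
by rewrite -ball_normE /= sub0r normrN ger0_norm.
Qed.

Lemma near0_positive (R : realType) (T : set R) :
  (\forall t \near 0, T t) -> exists2 t, 0 < t & T t.
Proof.
move=> /nbhs_ballP[e /= e0 eT]; exists (e / 2); first by rewrite divr_gt0.
apply: eT; rewrite -ball_normE /= sub0r normrN.
by rewrite ger0_norm ?divr_ge0 ?ltW// ltr_pdivrMr// mulr_natr mulr2n ltrDl.
Qed.

Section Plane.
Variables (R : realType) (d : nat).
Local Notation E := 'rV[R]_d.
Implicit Types (A B K L P : set E) (a b c p q x y z u v r w : E) (s t h : R).

(** The parameters outside the interior form a closed set, bounded above because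
    [u] is a recession direction and nonempty because [- u] is not. *)
Lemma boundary_on_line L c u : closed L -> @convex_set R E L -> L° c ->
  rec_cone L u -> ~ rec_cone L (- u) ->
  exists2 s, ~ L° (c + s *: u) & forall t, s < t -> L° (c + t *: u).
Proof.
move=> cL kL Lc Lu nLu; pose T := [set s : R | (~` L°) (c + s *: u)].
have T0 : T !=set0.
  have [t t0 nL] := ray_exit c cL kL nLu; exists (- t) => /interior_subset.
  by rewrite scaleNr -scalerN.
have Tub : ubound T 0.
  move=> s Ts; rewrite leNgt; apply/negP => s0; apply: Ts.
  by apply: interior_rec => //; apply: rec_coneZ => //; exact: ltW.
have Ts : T (sup T).
  have : closed T by apply: closed_line; exact/open_closedC/open_interior.
  by apply; apply: closure_sup => //; exists 0.
exists (sup T) => // t st; apply: contrapT => nLt.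
have : t <= sup T by apply: ub_le_sup => //; exists 0.
by rewrite leNgt st.
Qed.

Lemma interior_between L p u s t : @convex_set R E L ->
  L° (p + s *: u) -> s <= 0 < t -> L (p + t *: u) -> L° p.
Proof.
move=> kL Ls /andP[s0 t0] Lt; have ts : 0 < t - s by lra.
pose w := t / (t - s).
have w0 : w * s + (1 - w) * t = 0 by rewrite /w; field; rewrite gt_eqF.
have -> : p = w *: (p + s *: u) + (1 - w) *: (p + t *: u).
  transitivity (p + (w * s + (1 - w) * t) *: u); first by rewrite w0 scale0r addr0.
  by apply/rowP => i; rewrite !mxE; ring.
by apply: interior_segment => //; rewrite /w divr_gt0//= ler_pdivrMr//; lra.
Qed.

Lemma dot_delta x i : dot ('e_i : E) x = x 0 i.
Proof.
rewrite /dot (bigD1 i)//= big1 => [|j ji]; first by rewrite !mxE !eqxx mul1r addr0.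
by rewrite !mxE eqxx (negbTE ji) mul0r.
Qed.

(** The half-plane is generated by a point and three directions, over the zero
    cone. *)
Lemma half_plane_polyhedron p v u : (0 < d)%N ->
  polyhedron [set x | exists s t, 0 <= s /\ x = p + s *: v + t *: u].
Proof.
move=> hd.
pose F : seq (E * R) := [:: (p, 1); (v, 0); (u, 0); (- u, 0)].
pose C : seq E := [seq 'e_i | i <- enum 'I_d] ++ [seq - 'e_i | i <- enum 'I_d].
have := polyhedron_generated C F hd.
set P := [set _ | _]; set Q := [set _ | _]; suff -> : P = Q by [].
apply/seteqP; split => x.
  move=> [w [w0]]; rewrite /F !big_ord_recl !big_ord0 /= /bump /= => w1 wC.
  exists (w 1%N), (w 2%N - w 3%N); split => //.
  have {}w1 : w 0%N = 1 by lra.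
  apply/eqP; rewrite -subr_eq0; apply/eqP/rowP => i; rewrite [RHS]mxE.
  have := wC 'e_i; have := wC (- 'e_i).
  have iC : 'e_i \in [seq ('e_i : E) | i <- enum 'I_d] by rewrite map_f ?mem_enum.
  have niC : - 'e_i \in [seq (- 'e_i : E) | i <- enum 'I_d].
    by apply: (map_f (fun i => - 'e_i : E)); rewrite mem_enum.
  rewrite !mem_cat iC niC orbT /= => /(_ isT) + /(_ isT).
  by rewrite dotNl !dot_delta w1 !mxE !addn0 => h1 h2; lra.
move=> [s [t [s0 ->]]].
exists (fun i => [:: 1; s; `|t| + t; `|t|]`_i); split.
- move=> [|[|[|[|i]]]] //=; last by rewrite nth_nil.
  by have := ler_normr t (- t); have := ler_norm (- t); rewrite normrN; lra.
- by rewrite /F !big_ord_recl big_ord0 /= /bump /=; lra.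
- move=> c _; rewrite /F !big_ord_recl big_ord0 /= /bump /=.
  rewrite (_ : _ - _ = 0) ?dot0r//; apply/rowP => i; rewrite !mxE; ring.
Qed.

Lemma convex_plane_set (Q : R -> R -> Prop) p v u :
  (forall s1 (y1 : R) s2 (y2 : R) t, 0 < t < 1 -> Q s1 y1 -> Q s2 y2 ->
    Q (t * s1 + (1 - t) * s2) (t * y1 + (1 - t) * y2)) ->
  @convex_set R E [set x | exists s (y : R), Q s y /\ x = p + s *: v + y *: u].
Proof.
move=> HQ; apply/convex_segP => x y t /andP[].
rewrite le_eqVlt => /predU1P[<- _ _ yP|t0]; first by rewrite scale0r add0r subr0 scale1r.
rewrite le_eqVlt => /predU1P[-> xP _|t1]; first by rewrite subrr scale0r addr0 scale1r.
move=> [s1 [y1 [Q1 ->]]] [s2 [y2 [Q2 ->]]].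
exists (t * s1 + (1 - t) * s2), (t * y1 + (1 - t) * y2).
split; first by apply: HQ; rewrite ?t0.
by apply/rowP => i; rewrite !mxE; ring.
Qed.

(** In the coordinates [(s, y)] for the point [p + s v + y u], let [M] be the
    supremum of the heights of the hull [H] over [s = 1].  If it is infinite, [H]
    comes arbitrarily close to [(0, 1)]; but over [s = 0] there are only the
    heights [y <= 0].  If it is finite and attained, then all points of [S] lie
    below the line [y = M s], and strictly so for [0 < s]: a point of [S] on this
    line could be pushed away from an interior point of [L] with [s = lam] and
    [y < 0] to a point of [S] above the line.  Hence [(1, M)] is not in [H]. *)
Lemma half_plane_not_closed L p v u : (0 < d)%N -> closed L -> @convex_set R E L ->
  ~ L° p -> (forall t, 0 < t -> L° (p + t *: u)) -> ~ L° (p + v) ->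
  (forall t, 0 <= t -> ~ L° (p + v + t *: u)) \/
    (exists2 lam, 0 < lam < 1 & L° (p + lam *: v)) ->
  exists2 P : set E, polyhedron P & ~ closed (RL L P).
Proof.
move=> hd cL kL nLp Lpu nLpv alt.
pose P := [set x : E | exists s (y : R), 0 <= s /\ x = p + s *: v + y *: u].
exists P; first exact: half_plane_polyhedron.
pose q (s y : R) : E := p + s *: v + y *: u.
have free0 s (y : R) : s *: v + y *: u = 0 -> s = 0 /\ y = 0.
  move=> svyu; have uN0 : u != 0.
    by apply/eqP => u0; have := Lpu 1 ltr01; rewrite u0 scaler0 addr0.
  have [s0|sN0] := eqVneq s 0.
    split => //; move: svyu; rewrite s0 scale0r add0r => /eqP.
    by rewrite scaler_eq0 (negbTE uN0) orbF => /eqP.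
  exfalso; pose k := - y / s.
  have vk : v = k *: u.
    apply: (scalerI sN0); rewrite scalerA mulrC mulfVK// scaleNr.
    by apply/eqP; rewrite -addr_eq0 svyu.
  have k0 : k <= 0.
    by rewrite leNgt; apply/negP => k0; apply: nLpv; rewrite vk; exact: Lpu.
  case: alt => [h|[lam /andP[l0 l1]]]; last first.
    rewrite vk scalerA => Llk; apply: nLp.
    have lk : lam * k <= 0 < (1 : R) by clear -l0 k0; rewrite ltr01 andbT mulr_ge0_le0// ltW.
    exact (interior_between kL Llk lk (interior_subset (Lpu 1 ltr01))).
  have /h : 0 <= 1 - k by lra.
  by apply; rewrite vk -addrA -scalerDl; apply: Lpu; lra.
have qinj s (y : R) s' (y' : R) : q s y = q s' y' -> s = s' /\ y = y'.
  move=> qq; have /free0[] : (s - s') *: v + (y - y') *: u = 0.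
    move/eqP: qq; rewrite -subr_eq0 => /eqP <-.
    by apply/rowP => i; rewrite !mxE; ring.
  by move=> /eqP + /eqP; rewrite !subr_eq0 => /eqP -> /eqP ->.
have Lp : L p.
  have : closed [set t : R | L (p + t *: u)] by exact: closed_line.
  move=> /closed_contains0 -/(_ _)/= h; rewrite -[p]addr0 -(scale0r u); apply: h => e e0.
  exists (e / 2); rewrite ltr_pdivrMr// divr_ge0 ?ltW//= mulr_natr mulr2n ltrDl e0.
  by split => //; apply: interior_subset; apply: Lpu; rewrite divr_gt0.
have qseg s (y : R) s' (y' : R) t :
    t *: q s y + (1 - t) *: q s' y' = q (t * s + (1 - t) * s') (t * y + (1 - t) * y').
  by apply/rowP => i; rewrite !mxE; ring.
pose S := P `\` L°; rewrite -[RL L P]/(convex_hull S) => cH.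
have hS : convex_set (convex_hull S) := hull_convex (A := S).
move/convex_segP in hS.
have hp : convex_hull S (q 0 0).
  apply: sub_hull; split; first by exists 0, 0.
  by rewrite /q !scale0r !addr0.
pose T := [set t | convex_hull S (q 1 t)].
have T0 : T 0.
  apply: sub_hull; split; first by exists 1, 0.
  by rewrite /q scale0r addr0 scale1r.
have [Tub|nTub] := pselect (has_ubound T); last first.
  have : ~ convex_hull S (q 0 1).
    pose D := [set x : E | exists s (y : R),
      (0 < s \/ (s = 0 /\ y <= 0)) /\ x = p + s *: v + y *: u].
    move=> /(@hull_min _ _ S D)[||s [y [Qsy /qinj[E1 E2]]]];
      last by move: Qsy; rewrite -E1 -E2; lra.
      apply: convex_plane_set => s1 y1 s2 y2 t /andP[t0 t1].
      move=> [s10|[-> y10]] [s20|[-> y20]]; [left; nra|left; nra|left; nra|right; split; nra].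
    move=> x [[s [y [s0 ->]]] nLx]; exists s, y; split => //.
    have [s_eq0|sN0] := eqVneq s 0; last by left; rewrite lt_neqAle eq_sym sN0.
    right; split => //; rewrite leNgt; apply/negP => y0; apply: nLx.
    by rewrite s_eq0 scale0r addr0; apply: Lpu.
  apply; have : closed [set s : R | convex_hull S ((p + 1 *: u) + s *: v)].
    exact: closed_line.
  move=> /closed_contains0 h; rewrite /q addrAC; apply: h => e e0 /=.
  have [t tT te] : exists2 t, T t & e^-1 + 1 < t.
    apply: contrapT => h; apply: nTub; exists (e^-1 + 1) => t Tt.
    by rewrite leNgt; apply/negP => te; apply: h; exists t.
  have ei : 0 < e^-1 by rewrite invr_gt0.
  have t0 : 0 < t by lra.
  exists t^-1; split.
    by rewrite ltW ?invr_gt0//= invf_plt// ?posrE//; lra.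
  have -> : p + 1 *: u + t^-1 *: v = t^-1 *: q 1 t + (1 - t^-1) *: q 0 0.
    by rewrite qseg !mulr0 !addr0 mulr1 mulVf ?gt_eqF// /q addrAC.
  by apply: hS => //; rewrite ltW ?invr_gt0//= invf_le1//; lra.
pose M := sup T.
have TM : T M.
  have : closed T by apply: (closed_line (x := p + 1 *: v)).
  by apply; apply: closure_sup => //; exists 0.
have Tle t : T t -> t <= M by move=> Tt; apply: ub_le_sup.
have M0 : 0 <= M by exact: Tle.
have slope s (y : R) : 0 < s -> ~ L° (q s y) -> y <= M * s.
  move=> s0 nLs; rewrite -ler_pdivrMr//; apply: Tle; have [s1|s1] := leP 1 s.
    have -> : T (y / s) = convex_hull S (s^-1 *: q s y + (1 - s^-1) *: q 0 0).
      by rewrite qseg !mulr0 !addr0 mulVf ?gt_eqF// mulrC.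
    apply: hS => //; first by rewrite ltW ?invr_gt0//= invf_le1.
    by apply: sub_hull; split => //; exists s, y; rewrite ltW.
  apply: sub_hull; split; first by exists 1, (y / s).
  move=> Lq; apply: nLs.
  have -> : q s y = s *: q 1 (y / s) + (1 - s) *: q 0 0.
    by rewrite qseg !mulr0 !addr0 mulr1 mulrC mulfVK ?gt_eqF.
  have s01 : 0 < s <= 1 by clear -s0 s1; rewrite s0 ltW.
  have Lq0 : L (q 0 0) by clear -Lp; rewrite /q !scale0r !addr0.
  exact (interior_segment kL s01 Lq Lq0).
have strict s (y : R) : 0 < s -> ~ L° (q s y) -> y < M * s.
  move=> s0 nLs; rewrite lt_neqAle slope// andbT; apply/eqP => yE.
  case: alt => [h|[lam /andP[l0 l1] Llam]].
    have : T (M + 1).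
      apply: sub_hull; split; first by exists 1, (M + 1).
      by rewrite /q scale1r; apply: h; lra.
    by move=> /Tle; lra.
  have [eps eps0 Leps] : exists2 eps, 0 < eps & L° (q lam (- eps)).
    have [e e0 Le] := near0_positive (interior_line (- u) Llam).
    by clear -e0 Le; exists e => //; rewrite /q scaleNr -scalerN; exact Le.
  pose k := s / lam; have k0 : 0 < k by rewrite divr_gt0.
  have kl : k * lam = s by rewrite /k mulfVK ?gt_eqF.
  have : ~ L° (q (s + k * (s - lam)) (y + k * (y + eps))).
    move=> Lz; apply: nLs; clear -Lz Leps k0 kL qseg.
    have k1 : 1 + k != 0 by rewrite gt_eqF// addr_gt0.
    have -> : q s y = (1 + k)^-1 *: q (s + k * (s - lam)) (y + k * (y + eps)) +
        (1 - (1 + k)^-1) *: q lam (- eps).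
      by rewrite qseg; congr q; field.
    apply: interior_segment => //; last exact: interior_subset.
    by rewrite invr_gt0 addr_gt0//= invf_le1 ?addr_gt0// lerDl ltW.
  move=> /slope h; have /h {}h : 0 < s + k * (s - lam).
    by rewrite mulrBr kl addrC subrK mulr_gt0.
  have ke : 0 < k * eps by rewrite mulr_gt0.
  have Mkl : 0 <= M * (k * lam) by clear -M0 s0 kl; rewrite kl mulr_ge0 // ltW.
  clear -h yE ke Mkl; rewrite yE in h. lra.
pose D := [set x : E | exists s (y : R),
  ((0 <= s /\ y < M * s) \/ (s = 0 /\ y = 0)) /\ x = p + s *: v + y *: u].
have /(@hull_min _ _ S D)[||s [y [Qsy /qinj[E1 E2]]]] := TM;
  last by move: Qsy; rewrite -E1 -E2; lra.
  apply: convex_plane_set => s1 y1 s2 y2 t /andP[t0 t1].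
  have t1' : 0 < 1 - t by lra.
  clear -t0 t1 t1' M0; move=> [[s10 y10]|[-> ->]] [[s20 y20]|[-> ->]];
    last by right; split; ring.
  - left; split; first by rewrite addr_ge0// mulr_ge0// ltW.
    have h1 : 0 < t * (M * s1 - y1) by rewrite mulr_gt0// subr_gt0.
    have h2 : 0 < (1 - t) * (M * s2 - y2) by rewrite mulr_gt0// subr_gt0.
    lra.
  - left; rewrite !mulr0 !addr0; split; first by rewrite mulr_ge0// ltW.
    by rewrite mulrCA ltr_pM2l.
  - left; rewrite !mulr0 !add0r; split; first by rewrite mulr_ge0// ltW.
    by rewrite mulrCA ltr_pM2l.
move=> x [[s [y [s0 ->]]] nLx]; exists s, y; split => //.
have [s_eq0|sN0] := eqVneq s 0; last first.
  by left; split => //; apply: strict => //; rewrite lt_neqAle eq_sym sN0.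
move: nLx; rewrite s_eq0 scale0r addr0 => nLx.
have := lexx y; rewrite le_eqVlt; case: (ltgtP y 0) => [y0 _|y0|->]; last by right.
  by left; rewrite mulr0.
by exfalso; apply: nLx; exact: Lpu.
Qed.
End Plane.

(** * Necessity of the condition *)

Section Necessity.
Variables (R : realType) (d : nat).
Local Notation E := 'rV[R]_d.
Implicit Types (A B K L P : set E) (a b c p q x y z u v r w : E) (s t h : R).

(** If no chord existed, any point [y] strictly below a supporting hyperplane would
    be interior: otherwise the segment from [y] through an interior point [z],
    prolonged far beyond the hyperplane, would be such a chord. *)
Lemma not_halfspace_chord L c0 x0 : closed L -> @convex_set R E L -> L° c0 -> ~ L° x0 ->
  ~ is_halfspace L ->
  exists a b t, [/\ 0 < t < 1, ~ L° a, ~ L° b & L° ((1 - t) *: a + t *: b)].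
Proof.
move=> cL kL Lc0 nLx0 nH; apply: contrapT => nchord; apply: nH.
have [|a aL] := supporting_hyperplane cL kL _ nLx0; first by exists c0.
pose V := [set dot a y | y in L°]; pose beta := sup V.
have V0 : V !=set0 by exists (dot a c0); exists c0.
have Vub : has_ubound V by exists (dot a x0) => _ [y Ly <-]; exact: ltW (aL _ Ly).
have aN0 : a != 0.
  by apply/eqP => a0; have := aL _ Lc0; rewrite a0 !dot0l ltxx.
have Lbeta y : L° y -> dot a y <= beta by move=> Ly; apply: ub_le_sup => //; exists y.
have c0beta : dot a c0 < beta.
  have [e e0 Le] := near0_positive (interior_line a Lc0).
  by apply: lt_le_trans (Lbeta _ Le); rewrite dotDr dotZr ltrDl mulr_gt0 ?dot_gt0.
have betaL y : dot a y < beta -> L° y.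
  move=> ybeta; apply: contrapT => nLy.
  have [_ [z Lz <-] yz] := sup_gt V0 ybeta.
  (* w lies beyond z as seen from y, so far that it leaves the slab *)
  pose k := (beta - dot a z + 1) / (dot a z - dot a y).
  have zy : 0 < dot a z - dot a y by rewrite subr_gt0.
  have k0 : 0 < k by rewrite divr_gt0//; have := Lbeta _ Lz; lra.
  pose w := z + k *: (z - y).
  have nLw : ~ L° w.
    move=> /Lbeta; rewrite /w dotDr dotZr dotBr /k mulfVK ?gt_eqF//; lra.
  apply: nchord; exists y, w, (1 + k)^-1; split => //.
    by rewrite invr_gt0 addr_gt0//= invf_lt1 ?addr_gt0// ltrDl.
  have k1 : 1 + k != 0 by rewrite gt_eqF// addr_gt0.
  have <- // : z = (1 - (1 + k)^-1) *: y + (1 + k)^-1 *: w.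
  by apply/rowP => i; rewrite !mxE; field.
have small (e : R) : 0 < e -> exists t, [/\ 0 < t, t < e & t <= 1].
  move=> e0; exists (Num.min (e / 2) 1).
  rewrite lt_min divr_gt0// ltr01 gt_min ge_min lexx orbT.
  by rewrite ltr_pdivrMr// mulr_natr mulr2n ltrDl e0.
have segE x t : x + t *: (c0 - x) = t *: c0 + (1 - t) *: x.
  by apply/rowP => i; rewrite !mxE; ring.
exists a, beta; split => //; apply/seteqP; split => x.
  move=> Lx; have : closed [set t : R | [set y | dot a y <= beta] (x + t *: (c0 - x))].
    by apply: closed_line; exact: closed_dot_le.
  move=> /closed_contains0 h; rewrite -[x]addr0 -(scale0r (c0 - x)); apply: h => e e0.
  have [t [t0 te t1]] := small e e0; exists t; rewrite ltW//; split => //=.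
  by apply: Lbeta; rewrite segE; apply: interior_segment => //; rewrite t0.
move=> xbeta; have : closed [set t : R | L (x + t *: (c0 - x))].
  exact: closed_line.
move=> /closed_contains0 h; rewrite -[x]addr0 -(scale0r (c0 - x)); apply: h => e e0.
have [t [t0 te t1]] := small e e0; exists t; rewrite ltW//; split => //=.
apply: interior_subset; apply: betaL; rewrite dotDr dotZr dotBr.
have xb : dot a x <= beta := xbeta.
have h1 : t * dot a c0 < t * beta by rewrite ltr_pM2l.
have h2 : (1 - t) * dot a x <= (1 - t) * beta by rewrite ler_wpM2l// subr_ge0.
lra.
Qed.

(** Let [a], [b] be the ends of a chord.  If the line through [a] along [u] misses
    the interior of [L], it serves as the missing line.  Otherwise [a] is moved
    up along [u] to the boundary point [p]; the inner point of the chord moves up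
    with it and stays interior. *)
Lemma not_closed_RL L : (0 < d)%N -> closed L -> @convex_set R E L -> L° !=set0 ->
  ~ is_halfspace L -> ~ is_linear_space (rec_cone L) ->
  exists2 P : set E, polyhedron P & ~ closed (RL L P).
Proof.
move=> hd cL kL [c0 Lc0] nH nlin.
have [u Lu nLu] : exists2 u, rec_cone L u & ~ rec_cone L (- u).
  apply: contrapT => h; apply: nlin.
  have sym u : rec_cone L u -> rec_cone L (- u).
    by move=> Lu; apply: contrapT => nLu; apply: h; exists u.
  apply: subspaceP; [exact: rec_cone0|exact: rec_coneD|].
  move=> t u Lu; have [t0|t0] := leP 0 t; first exact: rec_coneZ.
  by rewrite -[t]opprK scaleNr -scalerN; apply: rec_coneZ; [lra|exact: sym].
have [t t0 nLx0] := ray_exit c0 cL kL nLu.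
have {nLx0} nLx0 : ~ L° (c0 + t *: - u) by move=> /interior_subset.
have [a [b [lam [lam01 nLa nLb Lc]]]] := not_halfspace_chord cL kL Lc0 nLx0 nH.
have [miss|hit] := pselect (forall s, ~ L° (a + s *: u)).
  have [s nLp Lp] := boundary_on_line cL kL Lc0 Lu nLu.
  have pv : c0 + s *: u + (a - (c0 + s *: u)) = a by rewrite addrC subrK.
  have Lpu (r : R) : 0 < r -> L° (c0 + s *: u + r *: u).
    by clear -Lp => r0; rewrite -addrA -scalerDl; apply: Lp; rewrite ltrDl.
  refine (half_plane_not_closed hd cL kL nLp Lpu (v := a - (c0 + s *: u)) _ _).
    rewrite pv; exact nLa.
  left; rewrite pv => r _; exact (miss r).
have [s0 Ls0] : exists s0, L° (a + s0 *: u).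
  by apply: contrapT => h; apply: hit => s Ls; apply: h; exists s.
have [s nLp Lp] := boundary_on_line cL kL Ls0 Lu nLu.
have {nLp} nLp : ~ L° (a + (s0 + s) *: u) by rewrite scalerDl addrA.
have s1 : 0 <= s0 + s.
  rewrite leNgt; apply/negP => s1; apply: nLa; clear -s1 Lp.
  rewrite -[a]addr0 -[X in _ + X](scale0r u) -(subrr s0) scalerDl addrA; apply: Lp; lra.
pose p := a + (s0 + s) *: u; have pv : p + (b - p) = b by rewrite addrC subrK.
have Lpu (r : R) : 0 < r -> L° (p + r *: u).
  clear -Lp => r0; rewrite /p -addrA -scalerDl -addrA scalerDl addrA; apply: Lp; lra.
refine (half_plane_not_closed hd cL kL nLp Lpu (v := b - p) _ _).
  rewrite pv; exact nLb.
right; exists lam; first exact lam01.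
clear -Lu Lc lam01 s1; case/andP: lam01 => _ lam1.
rewrite (_ : _ + _ = (1 - lam) *: a + lam *: b + ((1 - lam) * (s0 + s)) *: u).
  by apply: interior_rec => //; apply: rec_coneZ => //; rewrite mulr_ge0// subr_ge0 ltW.
by rewrite /p; apply/rowP => i; rewrite !mxE; ring.
Qed.
End Necessity.

(** * Absorption of recession directions *)

Section Sufficiency.
Variables (R : realType) (d : nat).
Local Notation E := 'rV[R]_d.
Implicit Types (A B K L P : set E) (x y z u v w : E) (s t h : R).

Lemma convex_opposite_rays (A : set E) x u s t : @convex_set R E A ->
  0 <= s -> 0 <= t -> A (x + s *: u) -> A (x + t *: - u) -> A x.
Proof.
move=> /convex_segP cA s0 t0; have [->|sN0] := eqVneq s 0.
  by rewrite scale0r addr0.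
move=> As At; have sgt0 : 0 < s by rewrite lt_neqAle eq_sym sN0.
have st : 0 < s + t by rewrite ltr_wpDr.
have -> : x = (t / (s + t)) *: (x + s *: u) + (1 - t / (s + t)) *: (x + t *: - u).
  by apply/rowP => i; rewrite !mxE; field; rewrite gt_eqF.
apply: cA => //.
by rewrite divr_ge0 ?(ltW st)//= ler_pdivrMr// mul1r lerDr.
Qed.

(** Symmetry of [rec_cone L] enters here: a translation by a recession direction
    of [L] can be undone inside [L], so it preserves the complement of [L°]. *)
Lemma RL_rec_cone L K r x : closed L -> @convex_set R E L ->
  (forall u, rec_cone L u -> rec_cone L (- u)) ->
  rec_cone K r -> RL L K x -> RL L K (x + r).
Proof.
move=> cL kL Lsym Kr; apply: hull_shift => {}x [Kx nLx].
have [Lr|nLr] := pselect (rec_cone L r).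
  apply: sub_hull; split; first exact (rec_cone1 Kr Kx).
  move=> Lxr; apply: nLx; rewrite -(addrK r x); exact (interior_rec (Lsym _ Lr) Lxr).
have [t t0 nLt] := ray_exit (x + r) cL kL nLr.
have St : (K `\` L°) (x + r + t *: r).
  split; last by move=> /interior_subset.
  exact (Kr _ (rec_cone1 Kr Kx) _ t0).
have t1 : 0 < 1 + t by clear -t0; lra.
have -> : x + r = (1 + t)^-1 *: (x + r + t *: r) + (1 - (1 + t)^-1) *: x.
  clear -t1; have {}t1 : 1 + t != 0 by rewrite gt_eqF.
  by apply/rowP => i; rewrite !mxE; field.
have /convex_segP := @hull_convex _ _ (K `\` L°); apply.
- by clear -t0 t1; rewrite ltW ?invr_gt0//= invf_le1// lerDl.
- exact (sub_hull St).
- by apply: sub_hull; split; [exact Kx|exact nLx].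
Qed.

(** From each point of [K] both directions of the line leave [L] inside [K]. *)
Lemma RL_transversal_line L K w : closed L -> @convex_set R E L ->
  (forall u, rec_cone L u -> rec_cone L (- u)) -> @convex_set R E K ->
  rec_cone K w -> rec_cone K (- w) -> ~ rec_cone L w -> RL L K = K.
Proof.
move=> cL kL Lsym kK Kw Kw' nLw; apply/seteqP; split.
  by apply: hull_min => // x [].
have nLw' : ~ rec_cone L (- w) by move=> /Lsym; rewrite opprK.
move=> x Kx; have [t t0 nLt] := ray_exit x cL kL nLw.
have [s s0 nLs] := ray_exit x cL kL nLw'.
apply: (convex_opposite_rays (@hull_convex _ _ (K `\` L°)) t0 s0).
- by apply: sub_hull; split; [exact: Kw|move=> /interior_subset].
- by apply: sub_hull; split; [exact: Kw'|move=> /interior_subset].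
Qed.

Lemma hull_seq (F : seq E) x : convex_hull [set` F] x <->
  exists w : nat -> R, [/\ forall i, 0 <= w i, \sum_(i < size F) w i = 1 &
    x = \sum_(i < size F) w i *: nth 0 F i].
Proof.
split; last first.
  move=> [w [w0 w1 ->]]; apply: convex_sum => //; first exact: hull_convex.
  by move=> i; apply: sub_hull; rewrite /= mem_nth.
move: x; apply: hull_min.
  apply/convex_segP => x y t /andP[t0 t1] [w [w0 w1 ->]] [w' [w0' w1' ->]].
  exists (fun i => t * w i + (1 - t) * w' i); split.
  - by move=> i; rewrite addr_ge0// mulr_ge0// subr_ge0.
  - by rewrite big_split /= -!mulr_sumr w1 w1' !mulr1 addrC subrK.
  - by rewrite !scaler_sumr -big_split; apply: eq_bigr => i _ /=; rewrite !scalerA -scalerDl.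
move=> f /= fF; have kF : (index f F < size F)%N by rewrite index_mem.
exists (fun i => (i == index f F)%:R); split; first by move=> i; rewrite ler0n.
- rewrite (bigD1 (Ordinal kF))//= eqxx big1 ?addr0// => i ik.
  by rewrite (_ : (i == index f F :> nat) = false)//; apply: negbTE.
- rewrite (bigD1 (Ordinal kF))//= eqxx big1 ?addr0 ?scale1r ?nth_index// => i ik.
  by rewrite (_ : (i == index f F :> nat) = false) ?scale0r//; apply: negbTE.
Qed.

Section Faces.
Variables (n : nat) (a : 'I_n -> E) (b : 'I_n -> R).

Let P : set E := [set x | forall i, dot (a i) x <= b i].
Let C : set E := [set r | forall i, dot (a i) r <= 0].

(** [C] is the recession cone of [P] when [P] is nonempty. *)
Definition hull_plus_cone (F : seq E) : set E :=
  [set z | exists x r, [/\ convex_hull [set` F] x, C r & z = x + r]].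
Local Notation Q := hull_plus_cone.

Lemma coneD u v : C u -> C v -> C (u + v).
Proof. by move=> Cu Cv i; rewrite dotDr -[0]addr0 lerD ?Cu ?Cv. Qed.

Lemma coneZ t u : 0 <= t -> C u -> C (t *: u).
Proof. by move=> t0 Cu i; rewrite dotZr mulr_ge0_le0 ?Cu. Qed.

Lemma cone_rec u : C u -> rec_cone P u.
Proof.
move=> Cu x Px t t0 i; rewrite dotDr -[b i]addr0.
by apply: lerD; [exact: Px|exact: (coneZ t0 Cu i)].
Qed.

Lemma hull_plus_cone_convex F : @convex_set R E (Q F).
Proof.
apply/convex_segP => _ _ t /andP[t0 t1] [x [r [hx Cr ->]]] [x' [r' [hx' Cr' ->]]].
exists (t *: x + (1 - t) *: x'), (t *: r + (1 - t) *: r'); split.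
- by have /convex_segP := @hull_convex _ _ [set` F]; apply; rewrite ?t0.
- by apply: coneD; apply: coneZ => //; rewrite subr_ge0.
- by rewrite !scalerDr addrACA.
Qed.

Lemma hull_plus_cone_sub F z : convex_hull [set` F] z -> Q F z.
Proof.
by move=> hz; exists z, 0; split; rewrite ?addr0// => i; rewrite dot0r.
Qed.

Lemma hull_plus_cone_mono F G z : {subset F <= G} -> Q F z -> Q G z.
Proof.
move=> FG [x [r [hx Cr ->]]]; exists x, r; split => //.
by apply: hull_mono hx => f /FG.
Qed.

Lemma hull_plus_coneD F z r : Q F z -> C r -> Q F (z + r).
Proof.
move=> [x [r' [hx Cr' ->]]] Cr; exists x, (r' + r).
by split; rewrite ?addrA//; exact: coneD.
Qed.

Lemma hull_plus_cone_polyhedron F : (0 < d)%N -> polyhedron (Q F).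
Proof.
move=> hd.
have := polyhedron_generated [seq a i | i <- enum 'I_n] [seq (f, 1) | f <- F] hd.
rewrite size_map; set A := [set _ | _]; suff -> : A = Q F by [].
have E1 (w : nat -> R) :
    \sum_(i < size F) w i * (nth 0 [seq (f, 1 : R) | f <- F] i).2 =
    \sum_(i < size F) w i.
  by apply: eq_bigr => i _; rewrite (nth_map 0)//= mulr1.
have E2 (w : nat -> R) :
    \sum_(i < size F) w i *: (nth 0 [seq (f, 1 : R) | f <- F] i).1 =
    \sum_(i < size F) w i *: nth 0 F i.
  by apply: eq_bigr => i _; rewrite (nth_map 0).
apply/seteqP; split => x.
  move=> [w]; rewrite E1 E2 => -[w0 w1 wC].
  exists (\sum_(i < size F) w i *: nth 0 F i), (x - \sum_(i < size F) w i *: nth 0 F i).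
  split; first by apply/hull_seq; exists w.
    by move=> i; apply: wC; rewrite map_f ?mem_enum.
  by rewrite addrC subrK.
move=> [y [r [/hull_seq[w [w0 w1 yE]] Cr ->]]]; exists w; rewrite E1 E2; split => //.
by move=> _ /mapP[i _ ->]; rewrite -yE addrC addKr; exact: Cr.
Qed.

Lemma ray_hits_facet x r : P x -> C r \/ exists t j,
  [/\ 0 <= t, 0 < dot (a j) r, P (x + t *: r) & dot (a j) (x + t *: r) = b j].
Proof.
move=> Px; have [Cr|nCr] := pselect (C r); [by left|right].
have [j0 j0r] : exists j0, 0 < dot (a j0) r.
  apply: contrapT => h; apply: nCr => i; rewrite leNgt; apply/negP => ir.
  by apply: h; exists i.
pose f j := (b j - dot (a j) x) / dot (a j) r.
have [j jr jmin] := @Order.TotalTheory.arg_minP _ _ _ j0 (fun j => 0 < dot (a j) r) f j0r.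
have t0 : 0 <= f j by rewrite divr_ge0// ?subr_ge0 ?Px// ltW.
exists (f j), j; split => //; last first.
  by rewrite dotDr dotZr /f mulfVK ?gt_eqF// addrC subrK.
move=> i; rewrite dotDr dotZr; have [ir|ir] := ltP 0 (dot (a i) r).
  by rewrite -lerBrDl -ler_pdivlMr//; exact: jmin.
by rewrite -[leRHS]addr0 lerD ?Px// mulr_ge0_le0.
Qed.
End Faces.
End Sufficiency.

(** * Images of polyhedra *)

Section PolyhedronFaces.
Variables (R : realType) (d : nat).
Local Notation E := 'rV[R]_d.
Variables (L : set E) (n : nat) (a : 'I_n -> E) (b : 'I_n -> R).
Hypotheses (cL : closed L) (kL : @convex_set R E L) (L0 : L° !=set0).
Implicit Types (x y z u v w r : E) (s t : R).

Let P : set E := [set x | forall i, dot (a i) x <= b i].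
Let S : set E := P `\` L°.
Let C r : Prop := forall i, dot (a i) r <= 0.
Let W r : Prop := forall i, dot (a i) r = 0.
Hypothesis WL : forall w, W w -> rec_cone L w.
Let U (I : {set 'I_n}) r : Prop := forall i, i \in I -> dot (a i) r = 0.
Let face (I : {set 'I_n}) x : Prop := forall i, i \in I -> dot (a i) x = b i.
Local Notation Q := (hull_plus_cone a).

Lemma closed_face_line y r : closed [set t : R | S (y + t *: r)].
Proof.
apply: closed_line; apply: closedI; last exact/open_closedC/open_interior.
rewrite (_ : P = \bigcap_(i in [set: 'I_n]) [set x | dot (a i) x <= b i]).
  by apply: closed_bigI => i _; exact: closed_dot_le.
by apply/seteqP; split => [x xi i _|x xi i]; [exact: xi|exact: (xi i I)].
Qed.

Lemma lineality_invariant x w : W w -> S x -> S (x - w).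
Proof.
move=> Ww [Px nLx]; split; first by move=> i; rewrite dotBr Ww subr0; exact: Px.
move=> Lxw; apply: nLx; rewrite -(subrK w x); exact (interior_rec (WL Ww) Lxw).
Qed.

(** A bounded closed set of parameters has a greatest element, which gives [f]; if
    the parameters are unbounded then [r] is a recession direction and [y] alone
    suffices. *)
Lemma half_line_generated y r : S y -> exists2 f, S f &
  forall c, 0 <= c -> S (y + c *: r) -> Q [:: y; f] (y + c *: r).
Proof.
move=> Sy; pose Z := [set t : R | S (y + t *: r)].
have Z0 : Z 0 by rewrite /Z /= scale0r addr0.
have [Zub|nZub] := pselect (has_ubound Z).
  have ZM : Z (sup Z) by apply: (@closed_face_line y r); apply: closure_sup => //; exists 0.
  exists (y + sup Z *: r); first exact: ZM.
  move=> c c0 Zc; have cM : c <= sup Z by apply: ub_le_sup.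
  apply: hull_plus_cone_sub; set F := [set` _].
  have Fy : convex_hull F y by apply: sub_hull; rewrite /F /= inE eqxx.
  have FM : convex_hull F (y + sup Z *: r).
    by apply: sub_hull; rewrite /F /= !inE eqxx orbT.
  have [M0|MN0] := eqVneq (sup Z) 0.
    have -> : c = 0 by apply/eqP; rewrite eq_le c0 -M0 cM.
    by rewrite scale0r addr0.
  have Mgt0 : 0 < sup Z by rewrite lt_neqAle eq_sym MN0 (le_trans c0).
  have -> : y + c *: r = (c / sup Z) *: (y + sup Z *: r) + (1 - c / sup Z) *: y.
    by apply/rowP => i; rewrite !mxE; field.
  have /convex_segP := @hull_convex _ _ F; apply => //.
  by rewrite divr_ge0 ?(ltW Mgt0)//= ler_pdivrMr// mul1r.
have Cr : C r.
  move=> i; rewrite leNgt; apply/negP => ir; apply: nZub.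
  exists ((b i - dot (a i) y) / dot (a i) r) => t [Pt _].
  by rewrite ler_pdivlMr// lerBrDl -dotZr -dotDr; exact: Pt.
exists y; first exact: Sy.
move=> c c0 _; apply: hull_plus_coneD; last exact: coneZ.
by apply: hull_plus_cone_sub; apply: sub_hull; rewrite /= inE eqxx.
Qed.

(** The hypothesis says that the face is at most one-dimensional modulo the
    lineality space [W], and then [S] can be moved by [W] into the line through
    [y] along [r0], whose two halves are generated separately. *)
Lemma edge_generated (I : {set 'I_n}) r0 : U I r0 ->
  (forall r, U I r -> exists c, W (r - c *: r0)) ->
  exists F : seq E, (forall f, f \in F -> S f) /\
    forall x, S x -> face I x -> Q F x.
Proof.
move=> Ur0 Udim; have [[y [Sy Iy]]|h] := pselect (exists y, S y /\ face I y); last first.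
  by exists [::]; split => // x Sx Ix; exfalso; apply: h; exists x.
have [f1 Sf1 Q1] := half_line_generated r0 Sy.
have [f2 Sf2 Q2] := half_line_generated (- r0) Sy.
exists [:: y; f1; f2]; split.
  by move=> f; rewrite !inE => /or3P[] /eqP->.
move=> x Sx Ix.
have [c Wc] : exists c, W (x - y - c *: r0).
  by apply: Udim => i iI; rewrite dotBr Ix// Iy// subrr.
have Sc : S (y + c *: r0).
  have -> : y + c *: r0 = x - (x - y - c *: r0) by apply/rowP => i; rewrite !mxE; ring.
  exact: lineality_invariant.
have -> : x = y + c *: r0 + (x - y - c *: r0) by apply/rowP => i; rewrite !mxE; ring.
apply: hull_plus_coneD; last by move=> i; rewrite Wc.
have [c0|c0] := leP 0 c.
  apply: hull_plus_cone_mono (Q1 c c0 Sc) => f; rewrite !inE => /orP[]->//.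
  by rewrite orbT.
have cN : 0 <= - c by rewrite oppr_ge0 ltW.
have cr : y + c *: r0 = y + (- c) *: - r0 by rewrite scaleNr scalerN opprK.
rewrite cr in Sc *; apply: hull_plus_cone_mono (Q2 _ cN Sc) => f.
by rewrite !inE => /orP[]->//; rewrite !orbT.
Qed.

(** Following the line both ways, one stays in [S] and meets facets, unless one
    direction is a recession direction; both directions are so only when the
    line direction is in [W]. *)
Lemma missed_line_generated (I : {set 'I_n}) (F : seq E) :
  (forall j x, j \notin I -> S x -> face (j |: I) x -> Q F x) ->
  forall x r, S x -> face I x -> U I r -> ~ W r ->
    (forall t, ~ L° (x + t *: r)) -> Q F x.
Proof.
move=> QF x r Sx Ix Ur nW miss.
have hit (r' : E) t j : U I r' -> (forall t, ~ L° (x + t *: r')) ->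
    0 < dot (a j) r' -> P (x + t *: r') -> dot (a j) (x + t *: r') = b j ->
    Q F (x + t *: r').
  move=> Ur' miss' jr' Pt jt; apply: (QF j).
  - by apply/negP => /Ur' jr0; rewrite jr0 ltxx in jr'.
  - by split; [exact Pt|exact (miss' t)].
  - move=> i; rewrite !inE => /orP[/eqP->//|iI].
    by rewrite dotDr dotZr Ur'// mulr0 addr0; exact: Ix.
have Ur' : U I (- r) by move=> i iI; rewrite dotNr Ur// oppr0.
have miss' t : ~ L° (x + t *: - r) by rewrite scalerN -scaleNr; exact (miss (- t)).
have [Px _] := Sx.
have [Cr|[t [j [t0 jr Pt jt]]]] := ray_hits_facet r Px;
  have [Cr'|[s [k [s0 kr Ps ks]]]] := ray_hits_facet (- r) Px.
- exfalso; apply: nW => i; apply/eqP; rewrite eq_le (Cr i) /=.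
  by rewrite -oppr_le0 -dotNr; exact (Cr' i).
- have Qy := hit _ _ _ Ur' miss' kr Ps ks.
  have -> : x = x + s *: - r + s *: r by rewrite scalerN subrK.
  by apply: hull_plus_coneD => //; exact: coneZ.
- have Qy := hit _ _ _ Ur miss jr Pt jt.
  have -> : x = x + t *: r + t *: - r by rewrite scalerN addrK.
  by apply: hull_plus_coneD => //; exact: coneZ.
- have Qy := hit _ _ _ Ur miss jr Pt jt.
  have Qz := hit _ _ _ Ur' miss' kr Ps ks.
  exact (convex_opposite_rays (hull_plus_cone_convex (a := a) (F := F)) t0 s0 Qy Qz).
Qed.

(** [I] is the set of constraints that are tight on the face, and it grows along
    the induction.  When the direction space [U I] contains two vectors that are
    independent modulo [W], some combination of them is orthogonal to the normal
    of any given supporting hyperplane, so [missed_line_generated] applies. *)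
Lemma faces_generated m (I : {set 'I_n}) : (#|~: I| <= m)%N ->
  exists F : seq E, (forall f, f \in F -> S f) /\
    forall x, S x -> face I x -> Q F x.
Proof.
elim: m I => [|m IH] I Im.
  have IT i : i \in I.
    by move: Im; rewrite leqn0 cards_eq0 => /eqP/setP/(_ i); rewrite !inE => /negbFE.
  apply: (@edge_generated I 0) => [i _|r Ur]; first by rewrite dot0r.
  by exists 0 => i; rewrite scaler0 subr0 Ur.
have /choice[Fj FjP] (j : 'I_n) : exists F : seq E, (forall f, f \in F -> S f) /\
    (j \notin I -> forall x, S x -> face (j |: I) x -> Q F x).
  have [jI|jI] := boolP (j \in I); first by exists [::]; split.
  have [|F [FS QF]] := IH (j |: I); last by exists F.
  rewrite -ltnS; apply: leq_trans Im; apply: proper_card.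
  rewrite properE; apply/andP; split; first by rewrite finset.setCS finset.subsetUr.
  by apply/subsetPn; exists j; rewrite !inE ?eqxx.
pose F := flatten [seq Fj j | j <- enum 'I_n].
have FS f : f \in F -> S f.
  by move=> /flattenP[_ /mapP[j _ ->] fj]; have [+ _] := FjP j; apply.
have QF j x : j \notin I -> S x -> face (j |: I) x -> Q F x.
  move=> jI Sx xj; have [_ /(_ jI x Sx xj)] := FjP j; apply: hull_plus_cone_mono.
  by move=> f fj; apply/flattenP; exists (Fj j) => //; rewrite map_f ?mem_enum.
have [[r0 [r1 [Ur0 Ur1 indep]]]|dep] := pselect (exists r0 r1, [/\ U I r0, U I r1 &
    forall s t, W (s *: r0 + t *: r1) -> s = 0 /\ t = 0]).
  exists F; split => // x Sx Ix; have [_ nLx] := Sx.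
  have [phi phiL] := supporting_hyperplane cL kL L0 nLx.
  have [s [t [st phist]]] : exists s t, ~ (s = 0 /\ t = 0) /\ dot phi (s *: r0 + t *: r1) = 0.
    have [r00|r00] := eqVneq (dot phi r0) 0.
      exists 1, 0; rewrite scale0r addr0 scale1r; split => //.
      by move=> [/eqP]; rewrite oner_eq0.
    exists (dot phi r1), (- dot phi r0); rewrite dotDr !dotZr; split; last by ring.
    by move=> [_ /eqP]; rewrite oppr_eq0 (negbTE r00).
  apply: (missed_line_generated QF Sx Ix (r := s *: r0 + t *: r1)).
  - by move=> i iI; rewrite dotDr !dotZr Ur0// Ur1// !mulr0 addr0.
  - by move=> /indep.
  - by move=> h /phiL; rewrite dotDr [dot phi (h *: _)]dotZr phist mulr0 addr0 ltxx.
have [[r0 [Ur0 nWr0]]|flat] := pselect (exists r0, U I r0 /\ ~ W r0); last first.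
  apply: (@edge_generated I 0) => [i _|r Ur]; first by rewrite dot0r.
  exists 0; rewrite scaler0 subr0; apply: contrapT => nW.
  by apply: flat; exists r.
apply: (@edge_generated I r0) => // r Ur.
have [s [t [Wst st]]] : exists s t, W (s *: r0 + t *: r) /\ ~ (s = 0 /\ t = 0).
  apply: contrapT => h; apply: dep; exists r0, r; split => // s t Wst.
  by apply: contrapT => st; apply: h; exists s, t.
have tN0 : t != 0.
  apply/eqP => t0; have [s0|sN0] := eqVneq s 0; first exact: st.
  apply: nWr0 => i; have := Wst i; rewrite t0 scale0r addr0 dotZr => /eqP.
  by rewrite mulf_eq0 (negbTE sN0) => /eqP.
exists (- (s / t)); rewrite (_ : _ - _ = t^-1 *: (s *: r0 + t *: r)).
  by move=> i; rewrite dotZr Wst mulr0.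
by apply/rowP => i; rewrite !mxE; field.
Qed.
End PolyhedronFaces.

Lemma RL_polyhedron (R : realType) (d : nat) (L P : set 'rV[R]_d) : (0 < d)%N ->
  closed L -> @convex_set R 'rV[R]_d L -> L° !=set0 ->
  (forall u, rec_cone L u -> rec_cone L (- u)) -> polyhedron P -> polyhedron (RL L P).
Proof.
move=> hd cL kL L0 Lsym polP.
have [n [a [b PE]]] := polyhedron_inequalities polP.
have CP u : (forall i, dot (a i) u <= 0) -> rec_cone P u by rewrite PE; exact: cone_rec.
have [[w [Ww nLw]]|WL] := pselect (exists w, (forall i, dot (a i) w = 0) /\ ~ rec_cone L w).
  rewrite (@RL_transversal_line _ _ _ _ w)//; first exact: polyhedron_convex.
    by apply: CP => i; rewrite Ww.
  by apply: CP => i; rewrite dotNr Ww oppr0.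
have [|F [FS SF]] := faces_generated (a := a) b cL kL L0 _
  (leqnn #|~: (finset.set0 : {set 'I_n})|).
  by move=> w Ww; apply: contrapT => nLw; apply: WL; exists w.
rewrite -PE in FS SF.
suff -> : RL L P = hull_plus_cone a F by exact: hull_plus_cone_polyhedron.
apply/seteqP; split.
  apply: hull_min; first exact: hull_plus_cone_convex.
  by move=> x Sx; apply: SF => // i; rewrite inE.
move=> _ [x [r [Fx Cr ->]]]; apply: RL_rec_cone => //; first exact: CP.
exact: hull_mono Fx.
Qed.

(** * Caratheodory's theorem *)

Section Caratheodory.
Variables (R : realType) (d : nat).
Local Notation E := 'rV[R]_d.
Implicit Types (A S K L : set E) (x y z u v w : E) (t : R).

Definition convex_comb n A x := exists (w : 'I_n -> R) (p : 'I_n -> E),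
  [/\ forall i, 0 <= w i, \sum_i w i = 1, forall i, A (p i) & x = \sum_i w i *: p i].

Lemma hull_convex_comb A x : convex_hull A x -> exists n, convex_comb n A x.
Proof.
move: x; apply: hull_min => [|x Ax]; last first.
  exists 1, (fun=> 1), (fun=> x); split => //; first by rewrite big_ord1.
  by rewrite big_ord1 scale1r.
apply/convex_segP => x y t /andP[t0 t1].
move=> [n [w [p [w0 w1 Ap ->]]]] [m [w' [p' [w0' w1' Ap' ->]]]].
exists (n + m)%N,
  (fun i => match fintype.split i with inl j => t * w j | inr k => (1 - t) * w' k end),
  (fun i => match fintype.split i with inl j => p j | inr k => p' k end).
have El j : fintype.split (lshift m j : 'I_(n + m)) = inl j by rewrite (unsplitK (inl j)).
have Er k : fintype.split (rshift n k : 'I_(n + m)) = inr k by rewrite (unsplitK (inr k)).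
split.
- by move=> i; case: (fintype.split i) => j; rewrite mulr_ge0// subr_ge0.
- rewrite big_split_ord /=.
  under eq_bigr do rewrite El; under [X in _ + X]eq_bigr do rewrite Er.
  by rewrite -!mulr_sumr w1 w1' !mulr1 addrC subrK.
- by move=> i; case: (fintype.split i).
- rewrite big_split_ord /= !scaler_sumr; congr (_ + _); apply: eq_bigr => i _.
    by rewrite El scalerA.
  by rewrite Er scalerA.
Qed.

Lemma convex_comb_pad n A x : convex_comb n A x -> convex_comb n.+1 A x.
Proof.
move=> [w [p [w0 w1 Ap ->]]].
have [i0 _] : exists i0 : 'I_n, true.
  case: n w p w0 w1 Ap => [|n] w p w0 w1 Ap; last by exists ord0.
  by move: w1; rewrite big_ord0 => /eqP; rewrite eq_sym oner_eq0.
exists (fun i => oapp w 0 (unlift ord0 i)), (fun i => oapp p (p i0) (unlift ord0 i)).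
split.
- by move=> i; case: unliftP => [j _|_] /=.
- rewrite big_ord_recl unlift_none /= add0r -[RHS]w1.
  by apply: eq_bigr => i _; rewrite liftK.
- by move=> i; case: unliftP => [j _|_] /=.
- rewrite big_ord_recl unlift_none /= scale0r add0r.
  by apply: eq_bigr => i _; rewrite liftK.
Qed.

(** The rows [(1, p i)] are more numerous than their columns. *)
Lemma affine_dependence n (p : 'I_n -> E) : (d.+1 < n)%N ->
  exists mu : 'I_n -> R, [/\ exists i, 0 < mu i, \sum_i mu i = 0 &
    \sum_i mu i *: p i = 0].
Proof.
move=> dn; pose M : 'M[R]_(n, 1 + d) := \matrix_i row_mx 1 (p i).
have : kermx M != 0.
  rewrite kermx_eq0; apply/negP => /eqP rM; have := rank_leq_col M.
  by rewrite rM leqNgt add1n dn.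
move=> /rowV0Pn[mu /sub_kermxP muM mu0].
have : \sum_i mu 0 i *: row_mx (1 : 'rV[R]_1) (p i) = 0.
  by rewrite -[RHS]muM mulmx_sum_row; apply: eq_bigr => i _; rewrite rowK.
rewrite (eq_bigr (fun i => row_mx (mu 0 i *: (1 : 'rV[R]_1)) (mu 0 i *: p i))); last first.
  by move=> i _; rewrite scale_row_mx.
have -> : \sum_i row_mx (mu 0 i *: (1 : 'rV[R]_1)) (mu 0 i *: p i) =
    row_mx (\sum_i mu 0 i *: (1 : 'rV[R]_1)) (\sum_i mu 0 i *: p i).
  elim: (index_enum _) => [|i s IH]; first by rewrite !big_nil row_mx0.
  by rewrite !big_cons IH add_row_mx.
rewrite -(row_mx0 R 1 1 d) => /eq_row_mx[/rowP/(_ 0) s1 sp].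
have {}s1 : \sum_i mu 0 i = 0.
  move: s1; rewrite summxE mxE => s1; rewrite -[RHS]s1; apply: eq_bigr => i _.
  by rewrite !mxE eqxx mulr1.
exists (fun i => mu 0 i); split => //; apply: contrapT => npos.
have neg i : 0 <= - mu 0 i.
  by rewrite oppr_ge0 leNgt; apply/negP => mi; apply: npos; exists i.
have s1N : \sum_i - mu 0 i = 0 by rewrite sumrN s1 oppr0.
move/eqP: mu0; apply; apply/rowP => i; rewrite mxE; apply/eqP.
by rewrite -oppr_eq0; apply/eqP; exact: (psumr_eq0P _ s1N).
Qed.

(** Move along an affine dependence until the first weight vanishes. *)
Lemma convex_comb_drop n A x : (d < n)%N -> convex_comb n.+1 A x -> convex_comb n A x.
Proof.
move=> dn [w [p [w0 w1 Ap xE]]].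
have [mu [[i0 mui0] mu1 mup]] := affine_dependence p (dn : (d.+1 < n.+1)%N).
have [i mui imin] := @Order.TotalTheory.arg_minP _ _ _ i0
  (fun i => 0 < mu i) (fun i => w i / mu i) mui0.
set tau := w i / mu i in imin; have tau0 : 0 <= tau by rewrite divr_ge0// ltW.
pose w' j := w j - tau * mu j.
have w'i : w' i = 0 by rewrite /w' /tau mulfVK ?subrr// gt_eqF.
exists (fun j => w' (lift i j)), (fun j => p (lift i j)); split.
- move=> j; rewrite /w' subr_ge0; have [muj|muj] := ltP 0 (mu (lift i j)).
    by rewrite -ler_pdivlMr//; exact: imin.
  by apply: le_trans (w0 _); rewrite mulr_ge0_le0.
- have : \sum_j w' j = 1 by rewrite sumrB -mulr_sumr mu1 mulr0 subr0.
  by rewrite (bigD1_ord i)//= w'i add0r.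
- by move=> j; exact: Ap.
- have : \sum_j w' j *: p j = x.
    under eq_bigr do rewrite scalerBl -scalerA.
    by rewrite sumrB -scaler_sumr mup scaler0 subr0 xE.
  by rewrite (bigD1_ord i)//= w'i scale0r add0r.
Qed.

(** The number of points is exactly [d.+1], with zero weights if need be, so that
    one index type serves for all [x]. *)
Lemma caratheodory A x : convex_hull A x -> convex_comb d.+1 A x.
Proof.
move=> /hull_convex_comb[n]; have [nd|dn] := leqP n d.+1.
  by rewrite -(subnK nd); elim: (d.+1 - n)%N => // k IH /IH; exact: convex_comb_pad.
rewrite -(subnK (ltnW dn)); elim: (n - d.+1)%N => // k IH.
by move=> h; apply: IH; apply: convex_comb_drop h; exact: leq_addl.
Qed.
End Caratheodory.

(** * Images of closed convex sets *)

Lemma cvg_near_unique (R : realType) (V : normedModType R) (T : Type)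
  (F : set_system T) (f g : T -> V) (a b : V) : ProperFilter F ->
  f x @[x --> F] --> a -> g x @[x --> F] --> b ->
  (\forall x \near F, f x = g x) -> a = b.
Proof.
move=> PF fa gb fg; apply: (@norm_cvg_unique _ _ (f x @[x --> F])) => //.
by apply: cvg_trans gb; apply: near_eq_cvg; apply: filterS fg => x ->.
Qed.

Section ClosedHull.
Variables (R : realType) (d : nat).
Local Notation E := 'rV[R]_d.
Implicit Types (A S K L : set E) (x y z u v w : E) (t : R).

(** The projection [prj] divides out the lines contained in [K].  For [y] near [x],
    [prj y] is a combination with weights [w i y] of the points [q i y] of [S].
    With [m y] comparable to the size of the summands, [1 / m] has a limit
    [minf], and the case [minf = 0] is the unbounded one. *)
Lemma closed_convex_hull S K (prj : {linear E -> E}) :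
  closed S -> closed K -> @convex_set R E K -> S `<=` K ->
  (forall r x, rec_cone K r -> convex_hull S x -> convex_hull S (x + r)) ->
  (forall x, S x -> S (prj x)) -> (forall x, rec_cone K (x - prj x)) ->
  (forall r, rec_cone K r -> rec_cone K (- r) -> prj r = 0) ->
  closed (convex_hull S).
Proof.
move=> cS cK kK SK hrec prjS prjK prj0 x clx.
have prjK2 y : prj (prj y) = prj y.
  have : prj (y - prj y) = 0.
    apply: prj0; first exact: prjK.
    by have := prjK (- y); rewrite linearN opprB opprK addrC.
  by move/eqP; rewrite linearB subr_eq0 => /eqP.
have cprj : continuous (prj : E -> E) by exact: rV_linear_continuous.
suff hx : convex_hull S (prj x) by rewrite -(subrK (prj x) x) addrC; exact: hrec.
pose F := within (convex_hull S) (nbhs x).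
have PF : ProperFilter F.
  apply: Build_ProperFilter => F0.
  have F0' : \forall z \near x, convex_hull S z -> set0 z by exact: F0.
  by have [z [hz /(_ hz)]] := clx _ F0'.
have [U [UU FU]] := ultraFilterLemma PF; have PU := @ultra_proper _ _ UU.
have Uh : \forall y \near U, convex_hull S y by apply: FU; exact: withinT.
have Ux : y @[y --> U] --> x by move=> B xB; apply: FU; exact: cvg_within xB.
have /choice[wq wqP] y : exists wq : ('I_d.+1 -> R) * ('I_d.+1 -> E),
    convex_hull S y -> [/\ forall i, 0 <= wq.1 i, \sum_i wq.1 i = 1,
      forall i, S (wq.2 i), forall i, prj (wq.2 i) = wq.2 i & prj y = \sum_i wq.1 i *: wq.2 i].
  have [/caratheodory[w [p [w0 w1 Sp ->]]]|nh] := pselect (convex_hull S y); last first.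
    by exists ((fun=> 0), (fun=> 0)).
  exists (w, fun i => prj (p i)) => _; split => //=; first by move=> i; exact: prjS.
  by rewrite linear_sum; apply: eq_bigr => i _; rewrite linearZ.
pose w i y := (wq y).1 i; pose q i y := (wq y).2 i.
have Uw0 i : \forall y \near U, 0 <= w i y by apply: filterS Uh => y /wqP[+ _ _ _ _]; apply.
have UqS i : \forall y \near U, S (q i y) by apply: filterS Uh => y /wqP[_ _ + _ _]; apply.
have Uw1 : \forall y \near U, \sum_i w i y = 1.
  by apply: filterS Uh => y /wqP[_ + _ _ _]; apply.
have Uprj : \forall y \near U, prj y = \sum_i w i y *: q i y.
  by apply: filterS Uh => y /wqP[_ _ _ _ +]; apply.
have UqP i : \forall y \near U, prj (q i y) = q i y.
  by apply: filterS Uh => y /wqP[_ _ _ + _]; apply.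
have [s0 Ss0] : exists s0, S s0 by have [y Sy] := filter_ex (UqS ord0); exists (q ord0 y).
have prjx : prj y @[y --> U] --> prj x.
  exact: (continuous_cvg PU (h := prj : E -> E) (cprj x) Ux).
have wl' i : exists l : R, w i y @[y --> U] --> l.
  have [|l _ h] := ultra_compact_cvg (f := w i) UU (@segment_compact R 0 1); last by exists l.
  apply: filterS2 (Uw1) (filter_forall PU Uw0) => y wy1 wy0 /=.
  rewrite in_itv /= wy0 -wy1 (bigD1 i)//= lerDl sumr_ge0// => j _; exact: wy0.
have [l wl] := choice wl'.
pose m y := 1 + \sum_i `|w i y *: q i y|.
have m1 y : 1 <= m y by rewrite lerDl sumr_ge0.
have m0 y : 0 < m y by apply: lt_le_trans (m1 y).
have [minf _ cminf] : exists2 c, [set` `[0 : R, 1]] c & (m y)^-1 @[y --> U] --> c.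
  apply: (ultra_compact_cvg (f := fun y => (m y)^-1) UU (@segment_compact R 0 1)).
  by apply: nearW => y /=; rewrite in_itv /= invr_ge0 ltW//= invf_le1.
have crho' i : exists rho : E, (m y)^-1 *: (w i y *: q i y) @[y --> U] --> rho.
  have cB : compact [set a : E | `|a| <= 1].
    apply: bounded_closed_compact.
      by exists 1; split => [|M M1 a /= a1]; [rewrite num_real|apply: le_trans a1 (ltW M1)].
    apply: (preimage_closed (f := fun a : E => `|a|) (D := [set s | s <= 1]));
      last exact: closed_le.
    by move=> a _; exact: norm_continuous.
  have [|rho _ h] := ultra_compact_cvg
    (f := fun y => (m y)^-1 *: (w i y *: q i y)) UU cB; last by exists rho.
  apply: nearW => y /=; rewrite normrZ normfV (ger0_norm (ltW (m0 y))).
  rewrite mulrC ler_pdivrMr// mul1r.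
  rewrite /m (bigD1 i)//= addrCA lerDl addr_ge0// sumr_ge0//.
have [rho crho] := choice crho'.
have [minf0|minfN0] := eqVneq minf 0.
  (* the rescaled points tend to recession directions that add up to zero *)
  exfalso; rewrite minf0 in cminf.
  have rhoK i : rec_cone K (rho i).
    apply: (rec_cone_lim (F := U) (mu := fun y => (m y)^-1 * w i y) (z := q i)) => //.
    - by apply: filterS (Uw0 i) => y wy; rewrite mulr_ge0// invr_ge0 ltW.
    - by apply: filterS (UqS i) => y /SK.
    - by rewrite -(mul0r (l i)); apply: cvgM.
    - by under eq_fun do rewrite -scalerA; exact: crho.
  have sum_rho : \sum_i rho i = 0.
    have c1 : \sum_i (m y)^-1 *: (w i y *: q i y) @[y --> U] --> \sum_i rho i.
      exact: cvg_bigsum.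
    have c2 : (m y)^-1 *: prj y @[y --> U] --> 0 *: prj x by apply: cvgZ.
    rewrite -[RHS](scale0r (prj x)); apply: (cvg_near_unique PU c1 c2).
    by apply: filterS Uprj => y ->; rewrite scaler_sumr.
  have rho0 i : rho i = 0.
    have prjrho : prj (rho i) = rho i.
      have c1 := continuous_cvg PU (h := prj : E -> E) (cprj _) (crho i).
      apply: (cvg_near_unique PU c1 (crho i)).
      by apply: filterS (UqP i) => y qP; rewrite /= scalerA linearZ /= qP.
    rewrite -prjrho; apply: prj0 => //.
    rewrite (_ : - rho i = \sum_(j | j != i) rho j); first exact: rec_cone_sum.
    have := sum_rho; rewrite (bigD1 i)//= => /eqP.
    by rewrite addr_eq0 => /eqP->; rewrite opprK.
  have c1 : \sum_i `|(m y)^-1 *: (w i y *: q i y)| @[y --> U] --> \sum_i `|rho i|.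
    by apply: (@cvg_bigsum R R^o) => i; apply: cvg_norm.
  have c2 : (1 - (m y)^-1 : R) @[y --> U] --> (1 - 0 : R) by apply: cvgB => //; exact: cvg_cst.
  have : \sum_i `|rho i| = 1 - 0 :> R.
    apply: (@cvg_near_unique R R^o _ _ _ _ _ _ PU c1 c2); apply: nearW => y.
    under eq_bigr do rewrite normrZ normfV (ger0_norm (ltW (m0 y))).
    rewrite -mulr_sumr -[X in _ - X]mulr1 -{1}(mulVf (lt0r_neq0 (m0 y))) -mulrBr.
    by rewrite /m addrAC subrr add0r.
  by rewrite big1 => [|i _];
    [rewrite subr0 => /eqP; rewrite eq_sym oner_eq0|rewrite rho0 normr0].
pose z i := minf^-1 *: rho i.
have cz i : w i y *: q i y @[y --> U] --> z i.
  rewrite (_ : (fun y => w i y *: q i y) =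
    fun y => ((m y)^-1)^-1 *: ((m y)^-1 *: (w i y *: q i y))).
    by apply: cvgZ (crho i); exact: cvgV.
  by apply/funext => y; rewrite invrK scalerA divff ?scale1r// gt_eqF.
have suml : \sum_i l i = 1.
  have c1 : \sum_i w i y @[y --> U] --> \sum_i l i by exact: (@cvg_bigsum R R^o).
  apply: (@cvg_near_unique R R^o _ _ _ (fun=> 1) _ _ PU c1 _ Uw1).
  exact: cvg_cst.
have sumz : prj x = \sum_i z i.
  have c1 : \sum_i w i y *: q i y @[y --> U] --> \sum_i z i by exact: cvg_bigsum.
  exact: (cvg_near_unique PU prjx c1 Uprj).
have l0 i : 0 <= l i.
  apply: (closed_cvg (FF := PU) (fun s : R => 0 <= s) (@closed_ge _ _) _ _ (wl i)).
  exact: Uw0.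
have zK i : l i = 0 -> rec_cone K (z i).
  move=> li; apply: (rec_cone_lim (F := U) (mu := w i) (z := q i)) => //.
    by apply: filterS (UqS i) => y /SK.
  by rewrite -li.
have zS i : l i != 0 -> S ((l i)^-1 *: z i).
  move=> li; have c1 : (w i y)^-1 *: (w i y *: q i y) @[y --> U] --> (l i)^-1 *: z i.
    by apply: cvgZ (cz i); exact: cvgV.
  apply: (closed_cvg (FF := PU) _ cS _ _ c1).
  have wN0 : \forall y \near U, w i y != 0 by apply: (cvgr_neq0 _ (wl i)).
  by apply: filterS2 wN0 (UqS i) => y wy; rewrite scalerA mulVf// scale1r.
pose p i := if l i == 0 then s0 else (l i)^-1 *: z i.
pose r i := if l i == 0 then z i else 0.
have -> : prj x = \sum_i l i *: p i + \sum_i r i.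
  rewrite sumz -big_split; apply: eq_bigr => i _ /=; rewrite /p /r.
  case: eqVneq => [->|li]; first by rewrite scale0r add0r.
  by rewrite addr0 scalerA divff// scale1r.
apply: hrec.
  by apply: rec_cone_sum => i _; rewrite /r; case: eqP => [/zK//|_]; exact: rec_cone0.
apply: convex_sum => //; first exact: hull_convex.
by move=> i; apply: sub_hull; rewrite /p; case: eqVneq => [//|/zS].
Qed.

(** The projection is along the lineality space [V] of [K], which may be supposed
    to lie in [rec_cone L], so that it preserves the complement of [L°]. *)
Lemma RL_closed L K : closed L -> @convex_set R E L ->
  (forall u, rec_cone L u -> rec_cone L (- u)) -> closed K -> @convex_set R E K ->
  closed (RL L K).
Proof.
move=> cL kL Lsym cK kK.
have [[w [Kw Kw' nLw]]|KL] :=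
  pselect (exists w, [/\ rec_cone K w, rec_cone K (- w) & ~ rec_cone L w]).
  by rewrite (RL_transversal_line cL kL Lsym kK Kw Kw' nLw).
have [V VE] : is_linear_space [set w | rec_cone K w /\ rec_cone K (- w)].
  apply: subspaceP.
  - by rewrite /= oppr0; split; exact: rec_cone0.
  - by move=> u v [Ku Ku'] [Kv Kv']; split; rewrite ?opprD; exact: rec_coneD.
  - move=> t u [Ku Ku']; have [t0|t0] := leP 0 t.
      by split; rewrite -?scalerN; exact: rec_coneZ.
    have s0 : 0 <= - t by rewrite oppr_ge0 ltW.
    have -> : t *: u = - t *: - u by rewrite scalerN scaleNr opprK.
    by split; rewrite -?scalerN ?opprK; exact: rec_coneZ.
have Vrec w : w \in V -> rec_cone K w /\ rec_cone K (- w).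
  by move=> wV; have : [set` V] w by []; rewrite -VE.
pose prj : {linear E -> E} := (\1 - projv V)%VF.
have prjE x : prj x = x - projv V x by rewrite /prj /= add_lfunE opp_lfunE id_lfunE.
have VL v : v \in V -> rec_cone L v.
  by move=> /Vrec[Kv Kv']; apply: contrapT => nLv; apply: KL; exists v.
apply: (closed_convex_hull (K := K) (prj := prj)) => //.
- by apply: closedI => //; exact/open_closedC/open_interior.
- by move=> r x; exact: RL_rec_cone.
- move=> x [Kx nLx]; have pV := memv_proj V x; rewrite prjE; split.
    by have [_ h] := Vrec _ pV; exact: rec_cone1.
  by move=> Lx; apply: nLx; rewrite -(subrK (projv V x) x); exact (interior_rec (VL _ pV) Lx).
- by move=> x; rewrite prjE opprB addrC subrK; have [] := Vrec _ (memv_proj V x).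
- move=> r Kr Kr'; rewrite prjE projv_id ?subrr//.
  by have : [set w | rec_cone K w /\ rec_cone K (- w)] r by []; rewrite VE.
Qed.
End ClosedHull.

(** * The equivalence *)

Lemma RL_halfspace (R : realType) (d : nat) (L K : set 'rV[R]_d) a b : a != 0 ->
  L = [set x | dot a x <= b] -> @convex_set R 'rV[R]_d K ->
  RL L K = K `&` [set x | dot (- a) x <= - b].
Proof.
move=> aN0 LE kK.
have intE : L° = [set x | dot a x < b].
  apply/seteqP; split => x /=.
    move=> Lx; have [e e0 /interior_subset] := near0_positive (interior_line a Lx).
    rewrite LE /= dotDr dotZr; apply: lt_le_trans.
    by rewrite ltrDl mulr_gt0// dot_gt0.
  move=> xb; have near_x : \forall y \near x, dot a y < b.
    exact: (cvgr_lt _ (@dot_continuous R d a x)).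
  by apply: filterS near_x => y /ltW; rewrite LE.
rewrite /RL (_ : K `\` L° = K `&` [set x | dot (- a) x <= - b]).
  apply/hull_id/convex_setI => //; apply/convex_segP => x y t /andP[t0 t1] /=.
  rewrite !dotNl !lerN2 dotDr !dotZr => xb yb.
  rewrite (_ : b = t * b + (1 - t) * b); last by ring.
  by rewrite lerD// ler_wpM2l// subr_ge0.
by rewrite intE; apply/seteqP; split => x [Kx xb]; split => //; move: xb;
  rewrite /= dotNl lerN2 leNgt => /negP.
Qed.

Theorem theorem3p2 (R : realType) (d : nat) (hd : (0 < d)%N)
    (L : set 'rV[R]_d) (Lclosed : closed L)
    (Lconvex : @convex_set R 'rV[R]_d L) (Ldim : has_dim L d) :
  ((forall P : set 'rV[R]_d, polyhedron P -> polyhedron (RL L P)) <->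
   (forall K : set 'rV[R]_d, closed K -> @convex_set R 'rV[R]_d K ->
      closed (RL L K) /\ @convex_set R 'rV[R]_d (RL L K))) /\
  ((forall K : set 'rV[R]_d, closed K -> @convex_set R 'rV[R]_d K ->
      closed (RL L K) /\ @convex_set R 'rV[R]_d (RL L K)) <->
   (is_halfspace L \/ is_linear_space (rec_cone L))).
Proof.
have L0 := full_dim_interior Lconvex Ldim.
have Lsym : is_linear_space (rec_cone L) ->
    forall u, rec_cone L u -> rec_cone L (- u).
  by move=> [V ->] u /=; rewrite memvN.
have necessary : (forall P : set 'rV[R]_d, polyhedron P -> closed (RL L P)) ->
    is_halfspace L \/ is_linear_space (rec_cone L).
  move=> RLclosed; have [|nH] := pselect (is_halfspace L); first by left.
  right; apply: contrapT => nlin.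
  have [P polP] := not_closed_RL hd Lclosed Lconvex L0 nH nlin.
  by apply; exact: RLclosed.
have sufficient_polyhedron : is_halfspace L \/ is_linear_space (rec_cone L) ->
    forall P : set 'rV[R]_d, polyhedron P -> polyhedron (RL L P).
  move=> [[a [b [aN0 LE]]]|/Lsym Ls] P polP; last exact: RL_polyhedron.
  rewrite (RL_halfspace aN0 LE (polyhedron_convex polP)).
  by apply: polyhedronI => //; exact: polyhedron_le.
have sufficient_closed : is_halfspace L \/ is_linear_space (rec_cone L) ->
    forall K : set 'rV[R]_d, closed K -> @convex_set R 'rV[R]_d K ->
    closed (RL L K) /\ @convex_set R 'rV[R]_d (RL L K).
  move=> h K cK kK; split; last exact: hull_convex.
  case: h => [[a [b [aN0 LE]]]|/Lsym Ls]; last exact: RL_closed.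
  by rewrite (RL_halfspace aN0 LE kK); apply: closedI => //; exact: closed_dot_le.
have i_iii : (forall P : set 'rV[R]_d, polyhedron P -> polyhedron (RL L P)) ->
    is_halfspace L \/ is_linear_space (rec_cone L).
  by move=> h; apply: necessary => P polP; apply: polyhedron_closed; exact: h.
have ii_iii : (forall K : set 'rV[R]_d, closed K -> @convex_set R 'rV[R]_d K ->
      closed (RL L K) /\ @convex_set R 'rV[R]_d (RL L K)) ->
    is_halfspace L \/ is_linear_space (rec_cone L).
  move=> h; apply: necessary => P polP.
  by have [] := h P (polyhedron_closed polP) (polyhedron_convex polP).
split; split => h.
- exact: (sufficient_closed (i_iii h)).
- exact: (sufficient_polyhedron (ii_iii h)).
- exact: ii_iii.
- exact: sufficient_closed.
Qed.
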